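(* Let $n\ge 2$ be an integer. There is no algorithm which, given a timed automaton $\mathcal{A}$ with $n$ clocks, decides whether there exists a timed automaton $\mathcal{B}$ with $n-1$ clocks such that $L(\mathcal{B})=L(\mathcal{A})$.
   Context: $\mathcal{R}$ denotes the set of positive reals. A (finite) timed word over a finite alphabet $\Sigma$ is a sequence $t_1.a_1.t_2.a_2\ldots t_n.a_n$ with $t_i\in\mathcal{R}$ (time lapses between events) and $a_i\in\Sigma$; a timed language is a set of such words. A timed automaton (in the sense of Alur and Dill) has a finite set of real-valued clocks, a finite set of states with initial and final states, and finitely many transitions, each labelled by a letter of $\Sigma$ (no $\varepsilon$-transitions), carrying a diagonal-free clock guard (a Boolean combination of constraints $x\sim c$ with $x$ a clock, $c$ a nonnegative integer constant) and a set of clocks reset to zero. Clocks increase at rate 1 during time lapses; a timed word is accepted if some run on it ends in a final state. $L(\mathcal{A})$ is the timed language accepted by $\mathcal{A}$. *)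

(* Defs.v *)
From HB Require Import structures.
From mathcomp Require Import all_boot all_order all_algebra.
From mathcomp Require Import interval_inference classical_sets reals.

Set Implicit Arguments.
Unset Strict Implicit.
Unset Printing Implicit Defensive.

Import Order.TTheory GRing.Theory Num.Theory.

(* Clocks are 'I_n, states 'I_q, letters 'I_k. *)

Inductive comparison_op := OpLt | OpLe | OpEq | OpGe | OpGt.

Inductive guard (n : nat) :=
  | GTrue
  | GAtom of 'I_n & comparison_op & nat
  | GNot of guard n
  | GAnd of guard n & guard n
  | GOr of guard n & guard n.

Record transition (k q n : nat) := Transition {
  tr_source : 'I_q;
  tr_letter : 'I_k;
  tr_guard : guard n;
  tr_resets : {set 'I_n};
  tr_target : 'I_q }.

Record timed_automaton (k n : nat) := TimedAutomaton {
  nb_states : nat;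
  initial : {set 'I_nb_states};
  final : {set 'I_nb_states};
  transitions : seq (transition k nb_states n) }.

(* Goedel numbering. CodeSeq.code is MathComp's bijection seq nat -> nat, with
   code [::] = 0 and code (x :: s) = 2 ^ x * (2 * code s + 1). *)

Definition comparison_op_code (o : comparison_op) : nat :=
  match o with OpLt => 0 | OpLe => 1 | OpEq => 2 | OpGe => 3 | OpGt => 4 end.

Fixpoint guard_code n (g : guard n) : nat :=
  match g with
  | GTrue => CodeSeq.code [:: 0]
  | GAtom x o c => CodeSeq.code [:: 1; val x; comparison_op_code o; c]
  | GNot g1 => CodeSeq.code [:: 2; guard_code g1]
  | GAnd g1 g2 => CodeSeq.code [:: 3; guard_code g1; guard_code g2]
  | GOr g1 g2 => CodeSeq.code [:: 4; guard_code g1; guard_code g2]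
  end.

Definition set_code m (A : {set 'I_m}) : nat :=
  CodeSeq.code [seq val i | i <- enum A].

Definition transition_code k q n (e : transition k q n) : nat :=
  CodeSeq.code [:: val (tr_source e); val (tr_letter e);
    guard_code (tr_guard e); set_code (tr_resets e); val (tr_target e)].

(* The alphabet size is part of the input. *)
Definition automaton_code n (A : {k : nat & timed_automaton k n}) : nat :=
  let: existT k B := A in
  CodeSeq.code [:: k; nb_states B; set_code (initial B); set_code (final B);
    CodeSeq.code [seq transition_code e | e <- transitions B]].

Lemma CodeSeq_code_inj : injective CodeSeq.code.
Proof. exact: can_inj CodeSeq.codeK. Qed.

Lemma comparison_op_code_inj : injective comparison_op_code.
Proof. by case; case. Qed.

Lemma guard_code_inj n : injective (@guard_code n).
Proof.
elim=> [|x o c|g IHg|g1 IH1 g2 IH2|g1 IH1 g2 IH2]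
       [|x' o' c'|g'|g1' g2'|g1' g2'] /CodeSeq_code_inj //.
- by case=> /val_inj-> /comparison_op_code_inj-> ->.
- by case=> /IHg->.
- by case=> /IH1-> /IH2->.
- by case=> /IH1-> /IH2->.
Qed.

Lemma set_code_inj m : injective (@set_code m).
Proof.
move=> A B /CodeSeq_code_inj /(inj_map val_inj) eqAB.
by apply/setP=> i; rewrite -mem_enum eqAB mem_enum.
Qed.

Lemma transition_code_inj k q n : injective (@transition_code k q n).
Proof.
move=> [s a g r t] [s' a' g' r' t'] /CodeSeq_code_inj [] /=.
by move=> /val_inj-> /val_inj-> /guard_code_inj-> /set_code_inj-> /val_inj->.
Qed.

Lemma automaton_code_inj n : injective (@automaton_code n).
Proof.
move=> [k [q i f e]] [k' [q' i' f' e']] /CodeSeq_code_inj [] /=.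
move=> eqk eqq; case: k' / eqk e' => e'; case: q' / eqq i' f' e' => i' f' e'.
move=> /set_code_inj-> /set_code_inj-> /CodeSeq_code_inj.
by move=> /(inj_map (@transition_code_inj k q n))->.
Qed.

HB.instance Definition _ k q n :=
  Equality.copy (transition k q n) (inj_type (@transition_code_inj k q n)).

Section Semantics.
Local Open Scope ring_scope.
Variable R : realType.

Definition timed_word (k : nat) := seq ({posnum R} * 'I_k).

Definition valuation (n : nat) := 'I_n -> R.

Definition compare (o : comparison_op) (x y : R) : bool :=
  match o with
  | OpLt => x < y
  | OpLe => x <= y
  | OpEq => x == y
  | OpGe => y <= x
  | OpGt => y < x
  end.

Fixpoint sat n (nu : valuation n) (g : guard n) : bool :=
  match g with
  | GTrue => true
  | GAtom x o c => compare o (nu x) c%:R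
  | GNot g1 => ~~ sat nu g1
  | GAnd g1 g2 => sat nu g1 && sat nu g2
  | GOr g1 g2 => sat nu g1 || sat nu g2
  end.

Definition elapse n (nu : valuation n) (t : R) : valuation n :=
  fun x => nu x + t.

Definition reset n (nu : valuation n) (r : {set 'I_n}) : valuation n :=
  fun x => if x \in r then 0 else nu x.

Fixpoint accepts_from k n (A : timed_automaton k n) (s : 'I_(nb_states A))
    (nu : valuation n) (w : timed_word k) : Prop :=
  match w with
  | [::] => s \in final A
  | (t, a) :: w' =>
      exists2 e, e \in transitions A &
        [/\ tr_source e = s, tr_letter e = a,
            sat (elapse nu t%:num) (tr_guard e) &
            accepts_from (tr_target e)
              (reset (elapse nu t%:num) (tr_resets e)) w']
  end.

Definition language k n (A : timed_automaton k n) : set (timed_word k) :=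
  [set w | exists2 s, s \in initial A & accepts_from s (fun=> 0) w]%classic.

End Semantics.

Arguments language R {k n} A _.

(* Algorithms are partial recursive functions. Programs carry no arity; one
   applied to too few arguments has no value. *)

Inductive murec :=
  | MZero
  | MSucc
  | MProj of nat
  | MComp of murec & seq murec
  | MPrimRec of murec & murec
  | MMu of murec.

(* computes p xs y: the partial function of p is defined at xs with value y. *)
Inductive computes : murec -> seq nat -> nat -> Prop :=
  | computes_zero xs : computes MZero xs 0
  | computes_succ x xs : computes MSucc (x :: xs) x.+1
  | computes_proj i xs : i < size xs -> computes (MProj i) xs (nth 0 xs i)
  | computes_comp f gs xs ys z :
      computes_all gs xs ys -> computes f ys z -> computes (MComp f gs) xs z
  | computes_primrec0 f g xs y :
      computes f xs y -> computes (MPrimRec f g) (0 :: xs) y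
  | computes_primrecS f g m xs y z :
      computes (MPrimRec f g) (m :: xs) y -> computes g [:: m, y & xs] z ->
      computes (MPrimRec f g) (m.+1 :: xs) z
  | computes_mu f xs m (v : nat -> nat) :
      (forall i, i < m -> computes f (i :: xs) (v i).+1) ->
      computes f (m :: xs) 0 -> computes (MMu f) xs m
with computes_all : seq murec -> seq nat -> seq nat -> Prop :=
  | computes_nil xs : computes_all [::] xs [::]
  | computes_cons g gs xs y ys :
      computes g xs y -> computes_all gs xs ys ->
      computes_all (g :: gs) xs (y :: ys).

Definition algorithmically_decidable T (code : T -> nat) (P : T -> Prop) :=
  exists f : murec, forall x : T,
    (P x -> computes f [:: code x] 1) /\ (~ P x -> computes f [:: code x] 0).

(* Main.v *)
Require Import Defs.
From HB Require Import structures.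
From mathcomp Require Import all_boot all_order all_algebra.
From mathcomp Require Import interval_inference classical_sets reals.
From mathcomp Require Import boolp zify lra.
From Stdlib Require Import Relation_Operators Operators_Properties.

(**
A [murec] program is compiled to a counter program and then to a machine with a
queue, each rule of which may pop and push a symbol. Runs of the machine are
coded by timed words whose letters are the rules, in such a way that a symbol
pushed at date t is popped at date t + 1. Since time is dense such dates can
always be found, and two clocks suffice to recognize the words that do not code
a halting run, by guessing where they go wrong. The input u of the machine is
dictated by the constant of a single guard: in the initial phase a marker goes
round the queue, once per time unit, adding a token each time, and the end of
this phase must come exactly u time units after the first event.

Let the automaton A accept the words v c^j such that either v does not code a
halting run, or the c's occur at 2n dates T_1 < ... < T_2n with
T_(n+i) = T_i + 1. If no halting run exists, L(A) needs no clock at all.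
Otherwise fix v coding one: for generic dates an automaton with n - 1 clocks
forgets some T_i after n letters c, and accepts as well after a small change of
T_(n+i).

Finally let the input u be the code of the list of all transitions of A but the
one containing the constant u, with u also serving as the number of states and
letters; then the code of A is a simple function h(u). Running the alleged
decision procedure on h(u), and halting precisely if it says that A is
equivalent to an automaton with n - 1 clocks, is contradictory.
*)

Set Implicit Arguments.
Unset Strict Implicit.
Unset Printing Implicit Defensive.

Import Order.TTheory GRing.Theory Num.Theory.

(** * Compiling recursive functions to loop programs *)

Definition store := nat -> nat.

Definition upd (s : store) r v : store := fun x => if x == r then v else s x.

(* [Loop r c] is [while r > 0 do r := r - 1; c]. *)
Inductive com := Skip | Inc of nat | Seq of com & com | Loop of nat & com.

Inductive exec : com -> store -> store -> Prop :=
  | exec_skip s : exec Skip s s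
  | exec_inc r s : exec (Inc r) s (upd s r (s r).+1)
  | exec_seq c1 c2 s1 s2 s3 :
      exec c1 s1 s2 -> exec c2 s2 s3 -> exec (Seq c1 c2) s1 s3
  | exec_loop0 r c s : s r = 0 -> exec (Loop r c) s s
  | exec_loopS r c s1 s2 s3 m :
      s1 r = m.+1 -> exec c (upd s1 r m) s2 -> exec (Loop r c) s2 s3 ->
      exec (Loop r c) s1 s3.

Lemma exec_eq c s1 s2 s3 : exec c s1 s2 -> s2 =1 s3 -> exec c s1 s3.
Proof. by move=> e /funext <-. Qed.

Lemma exec_loop_iter r c (S : nat -> store) m :
  (forall i, i < m ->
    exists2 d, S i r = d.+1 & exec c (upd (S i) r d) (S i.+1)) ->
  S m r = 0 -> exec (Loop r c) (S 0) (S m).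
Proof.
elim: m S => [|m IH] S step Sm0; first exact: exec_loop0.
have [d Sd body] := step 0 isT.
apply: exec_loopS Sd body _; apply: (IH (S \o succn)) => // i.
exact: (step i.+1).
Qed.

Ltac upd_cases := rewrite /upd /=; repeat match goal with
  | |- context [@eq_op _ ?a ?b] => case: (a =P b) => ? end; subst;
  try first [by [] | lia | by exfalso; lia].

Definition clear r := Loop r Skip.
Definition move_reg a b := Loop a (Inc b).
Definition copy_reg a b t := Seq (Loop a (Seq (Inc t) (Inc b))) (move_reg t a).
Definition clear_all rs := foldr (fun r => Seq (clear r)) Skip rs.

Lemma exec_clear r s : exec (clear r) s (upd s r 0).
Proof.
pose S i := upd s r (s r - i); have -> : s = S 0.
  by apply: funext => x; rewrite /S subn0; upd_cases.
apply: (@exec_eq _ _ (S (s r))) => [|x]; last by rewrite /S; upd_cases.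
apply: exec_loop_iter => [i i_lt|]; last by rewrite /S; upd_cases.
exists (s r - i.+1); first by rewrite /S; upd_cases.
by apply: exec_eq (exec_skip _) _ => x; rewrite /S; upd_cases.
Qed.

Lemma exec_move a b s : a <> b ->
  exec (move_reg a b) s (upd (upd s b (s b + s a)) a 0).
Proof.
move=> ab; pose S i := upd (upd s b (s b + i)) a (s a - i).
have {1}-> : s = S 0 by apply: funext => x; rewrite /S; upd_cases.
apply: (@exec_eq _ _ (S (s a))) => [|x]; last by rewrite /S; upd_cases.
apply: exec_loop_iter => [i i_lt|]; last by rewrite /S; upd_cases.
exists (s a - i.+1); first by rewrite /S; upd_cases.
by apply: exec_eq (exec_inc _ _) _ => x; rewrite /S; upd_cases.
Qed.

Lemma exec_copy a b t s : a <> b -> a <> t -> b <> t -> s t = 0 ->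
  exec (copy_reg a b t) s (upd s b (s b + s a)).
Proof.
move=> ab at_ bt st0.
pose S i := upd (upd (upd s b (s b + i)) t i) a (s a - i).
apply: (@exec_seq _ _ _ (S (s a))); last first.
  apply: exec_eq (exec_move _ (not_eq_sym at_)) _ => x.
  by rewrite /S; upd_cases.
have {1}-> : s = S 0 by apply: funext => x; rewrite /S; upd_cases.
apply: exec_loop_iter => [i i_lt|]; last by rewrite /S; upd_cases.
exists (s a - i.+1); first by rewrite /S; upd_cases.
apply: exec_seq (exec_inc _ _) (exec_eq (exec_inc _ _) _) => x.
by rewrite /S; upd_cases.
Qed.

Lemma exec_clear_all rs s :
  exec (clear_all rs) s (fun x => if x \in rs then 0 else s x).
Proof.
elim: rs s => [|r rs IH] s /=; first exact: exec_skip.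
apply: exec_seq (exec_clear _ _) (exec_eq (IH _) _) => x.
by rewrite in_cons /upd; case: (x == r); case: (x \in rs).
Qed.

(* [compile f args out fr] adds to register [out] the value of [f] at the
   contents of the registers [args]; the registers from [fr] on are scratch
   space, zero before and after. *)
Fixpoint compile (f : murec) (args : seq nat) (out fr : nat) : com :=
  match f with
  | MZero => Skip
  | MSucc => Seq (copy_reg (head 0 args) out fr) (Inc out)
  | MProj i => copy_reg (nth 0 args i) out fr
  | MComp f gs =>
      let vals := iota fr (size gs) in let fr' := fr + size gs in
      Seq (foldr (fun g rest b => Seq (compile g args b fr') (rest b.+1))
             (fun=> Skip) gs fr)
        (Seq (compile f vals out fr') (clear_all vals))
  | MPrimRec f g =>
      let cnt := fr in let idx := fr.+1 in let acc := fr.+2 in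
      let new := fr.+3 in
      Seq (copy_reg (head 0 args) cnt idx)
      (Seq (compile f (behead args) acc fr.+4)
      (Seq (Loop cnt
             (Seq (compile g [:: idx, acc & behead args] new fr.+4)
             (Seq (clear acc) (Seq (move_reg new acc) (Inc idx)))))
      (Seq (clear idx) (move_reg acc out))))
  | MMu f =>
      let idx := fr in let val := fr.+1 in let flag := fr.+2 in
      Seq (Inc flag)
      (Seq (Loop flag
             (Seq (compile f (idx :: args) val fr.+3)
               (Loop val (Seq (clear val) (Seq (Inc idx) (Inc flag))))))
        (move_reg idx out))
  end.

Definition compile_each gs args fr : nat -> com :=
  foldr (fun g rest b => Seq (compile g args b fr) (rest b.+1)) (fun=> Skip) gs.

Definition frame (s : store) args out fr := [/\ all (fun a => a < fr) args,
  out < fr, out \notin args & forall r, fr <= r -> s r = 0].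

Definition compiled f xs y := forall args out fr s, map s args = xs ->
  frame s args out fr -> exec (compile f args out fr) s (upd s out (s out + y)).

Definition put (s : store) b ys : store :=
  fun x => if b <= x < b + size ys then nth 0 ys (x - b) else s x.

Lemma map_agree (s s' : store) args fr : all (fun a => a < fr) args ->
  (forall x, x < fr -> s' x = s x) -> map s' args = map s args.
Proof.
by move=> /allP args_fr s's; apply/eq_in_map => a /args_fr; apply: s's.
Qed.

Lemma frame_scratch (s : store) args fr out fr' : all (fun a => a < fr) args ->
  fr <= out < fr' -> (forall r, fr' <= r -> s r = 0) -> frame s args out fr'.
Proof.
move=> args_fr out_fr s0; split=> //; last 1 first.
- by apply/negP => /(allP args_fr); lia.
- by apply: sub_all args_fr => a; lia.
- by lia.
Qed.

Lemma compiled_zero xs : compiled MZero xs 0.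
Proof.
move=> args out fr s _ _; apply: exec_eq (exec_skip _) _ => x.
by upd_cases.
Qed.

Lemma compiled_succ x xs : compiled MSucc (x :: xs) x.+1.
Proof.
move=> [|a args] //= out fr s [<- _] [/andP[a_fr _] out_fr].
rewrite in_cons negb_or => /andP[oa _] s0.
apply: exec_seq (exec_copy _ _ _ _) _; try first [lia | by apply: s0].
by apply: exec_eq (exec_inc _ _) _ => z; upd_cases.
Qed.

Lemma compiled_proj i xs : i < size xs -> compiled (MProj i) xs (nth 0 xs i).
Proof.
move=> i_xs args out fr s def_xs [/allP a_fr o_fr o_a s0]; subst xs.
rewrite size_map in i_xs; have a_in := mem_nth 0 i_xs.
have /= a_lt := a_fr _ a_in; rewrite (nth_map 0) //=; apply: exec_copy.
- by move=> a_out; rewrite -a_out a_in in o_a.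
- by lia.
- by lia.
- exact: s0.
Qed.

Lemma compiled_each gs xs ys args b fr s :
  (forall g y, List.In g gs -> computes g xs y -> compiled g xs y) ->
  computes_all gs xs ys -> map s args = xs -> all (fun a => a < b) args ->
  b + size gs <= fr -> (forall r, b <= r -> s r = 0) ->
  exec (compile_each gs args fr b) s (put s b ys).
Proof.
elim: gs ys b s => [|g gs IH] ys b s cg cgs sargs args_b /= b_fr s0.
  inversion cgs; subst; apply: exec_eq (exec_skip _) _ => x.
  by rewrite /put ifF //=; lia.
inversion cgs as [|? ? ? y ys' gy gsys]; subst.
have run_g : exec (compile g args b fr) s (upd s b (s b + y)).
  apply: (cg g y _ gy) => //; first by left.
  by apply: frame_scratch args_b _ _; [lia | move=> r ?; apply: s0; lia].
apply: exec_seq run_g (exec_eq (IH ys' b.+1 _ _ gsys _ _ _ _) _).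
- by move=> g' y' ?; apply: cg; right.
- by apply: map_agree args_b _ => x ?; upd_cases.
- by apply: sub_all args_b => a; lia.
- by lia.
- by move=> r ?; rewrite /upd ifF ?s0 //; lia.
move=> x; rewrite /put /upd /= s0 // add0n.
case: (x =P b) => [->|nxb]; first by rewrite ifF ?ifT ?subnn //; lia.
case: (boolP (b.+1 <= x < _)) => x_in; last by rewrite ifF //; lia.
by rewrite ifT; [have -> : x - b = (x - b.+1).+1 by lia | lia].
Qed.

Lemma size_computes_all gs xs ys : computes_all gs xs ys -> size ys = size gs.
Proof.
elim: gs ys => [|g gs IH] ys cgs; inversion cgs; subst => //=.
by rewrite (IH _ _).
Qed.

Lemma compiled_comp f gs xs ys z :
  (forall g y, List.In g gs -> computes g xs y -> compiled g xs y) ->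
  computes_all gs xs ys -> compiled f ys z -> compiled (MComp f gs) xs z.
Proof.
move=> cg cgs cf args out fr s sargs [a_fr o_fr o_a s0] /=.
have sz := size_computes_all cgs.
apply: exec_seq (compiled_each cg cgs sargs a_fr (leqnn _) s0) _.
have run_f : exec (compile f (iota fr (size gs)) out (fr + size gs))
    (put s fr ys) (upd (put s fr ys) out (put s fr ys out + z)).
  apply: cf; last split.
  - apply: (@eq_from_nth _ 0) => [|i]; rewrite size_map size_iota // => i_gs.
    rewrite (nth_map 0) ?size_iota // nth_iota // /put sz ifT; last by lia.
    by congr nth; lia.
  - by apply/allP => i; rewrite mem_iota; lia.
  - by lia.
  - by rewrite mem_iota; lia.
  - by move=> r ?; rewrite /put sz ifF; [apply: s0|]; lia.
apply: exec_seq run_f (exec_eq (exec_clear_all _ _) _) => x.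
rewrite /upd /put sz mem_iota; case: ifP => x_in.
  by rewrite ifF; [rewrite s0 //|]; lia.
by case: ifP => // _; rewrite ifF //; lia.
Qed.

Lemma compiled_primrec f g m xs (v : nat -> nat) : compiled f xs (v 0) ->
  (forall i, i < m -> compiled g [:: i, v i & xs] (v i.+1)) ->
  compiled (MPrimRec f g) (m :: xs) (v m).
Proof.
move=> cf cg [|a args] //= out fr s [sa sargs] [/andP[a_fr args_fr] o_fr].
rewrite in_cons negb_or => /andP[oa o_args] s0.
have [cnt0 idx0 acc0 new0] :
    [/\ s fr = 0, s fr.+1 = 0, s fr.+2 = 0 & s fr.+3 = 0].
  by split; apply: s0; lia.
pose S i := upd (upd (upd s fr (m - i)) fr.+2 (v i)) fr.+1 i.
have S0 i r : fr.+3 <= r -> S i r = 0.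
  by move=> ?; have := s0 r; rewrite /S; upd_cases.
apply: exec_seq (exec_copy _ _ _ _) _; try lia.
set s1 := upd s _ _; have run_f : exec (compile f args fr.+2 fr.+4) s1 (S 0).
  apply: exec_eq (cf args fr.+2 fr.+4 _ _ _) _.
  - rewrite -sargs; apply: map_agree args_fr _ => x ?.
    by rewrite /s1; upd_cases.
  - apply: frame_scratch args_fr _ _; first by lia.
    by move=> r ?; have := s0 r; rewrite /s1; upd_cases.
  - by move=> x; rewrite /s1 /S sa; upd_cases.
apply: exec_seq run_f (exec_seq (exec_loop_iter (m := m) _ _) _); last first.
- apply: exec_seq (exec_clear _ _) (exec_eq (exec_move _ _) _); first by lia.
  by move=> x; rewrite /S; upd_cases.
- by rewrite /S; upd_cases.
move=> i im; exists (m - i.+1); first by rewrite /S; upd_cases.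
apply: exec_seq (cg i im [:: fr.+1, fr.+2 & args] fr.+3 fr.+4 _ _ _) _.
- rewrite /= -sargs (map_agree (s := s) args_fr) => [|x ?].
    by congr [:: _, _ & _]; rewrite /S; upd_cases.
  by rewrite /S; upd_cases.
- apply: (@frame_scratch _ _ fr.+3); [|by lia|].
    by apply/and3P; split; [lia | lia | apply: sub_all args_fr => x; lia].
  by move=> r ?; have := S0 i r; upd_cases.
apply: exec_seq (exec_clear _ _) (exec_seq (exec_move _ _) _); first by lia.
by apply: exec_eq (exec_inc _ _) _ => x; rewrite /S; upd_cases.
Qed.

Lemma compiled_mu f xs m (v : nat -> nat) :
  (forall i, i < m -> compiled f (i :: xs) (v i).+1) ->
  compiled f (m :: xs) 0 -> compiled (MMu f) xs m.
Proof.
move=> cf_lt cf_m args out fr s sargs [args_fr o_fr o_args s0] /=.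
have [idx0 val0 flag0] : [/\ s fr = 0, s fr.+1 = 0 & s fr.+2 = 0].
  by split; apply: s0; lia.
pose S i := upd (upd s fr (minn i m)) fr.+2 (i <= m).
have run_f i y : i <= m -> compiled f (i :: xs) y ->
    exec (compile f (fr :: args) fr.+1 fr.+3) (upd (S i) fr.+2 0)
      (upd (upd (S i) fr.+2 0) fr.+1 y).
  move=> im cf; apply: exec_eq (cf _ _ _ _ _ _) _.
  - rewrite /= -sargs (map_agree (s := s) args_fr) => [|x ?].
      by congr (_ :: _); rewrite /S; upd_cases.
    by rewrite /S; upd_cases.
  - apply: (@frame_scratch _ _ fr.+1); [|by lia|].
      by apply/andP; split; [lia | apply: sub_all args_fr => x; lia].
    by move=> r ?; have := s0 r; rewrite /S; upd_cases.
  - by move=> x; rewrite /S; upd_cases.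
apply: exec_seq (exec_inc _ _) _.
have {1}-> : upd s fr.+2 (s fr.+2).+1 = S 0.
  by apply: funext => x; rewrite /S; upd_cases.
apply: exec_seq (exec_loop_iter (m := m.+1) _ _) _; last first.
- apply: exec_eq (exec_move _ _) _; first by lia.
  by move=> x; rewrite /S; upd_cases.
- by rewrite /S; upd_cases.
move=> i; rewrite ltnS => im; exists 0; first by rewrite /S; upd_cases.
move: (im); rewrite leq_eqVlt => /predU1P[iE|i_lt].
  apply: exec_seq (run_f i 0 im _) _; first by rewrite iE.
  apply: exec_eq (exec_loop0 _ _) _; first by rewrite /S; upd_cases.
  by move=> x; rewrite /S; upd_cases.
apply: exec_seq (run_f i _ im (cf_lt i i_lt)) _.
apply: (@exec_loopS _ _ _ (S i.+1) _ (v i)); first by rewrite /S; upd_cases.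
  apply: exec_seq (exec_clear _ _) (exec_seq (exec_inc _ _) _).
  by apply: exec_eq (exec_inc _ _) _ => x; rewrite /S; upd_cases.
by apply: exec_loop0; rewrite /S; upd_cases.
Qed.

Lemma murec_nested_ind (P : murec -> Prop) :
  P MZero -> P MSucc -> (forall i, P (MProj i)) ->
  (forall f gs, P f -> (forall g, List.In g gs -> P g) -> P (MComp f gs)) ->
  (forall f g, P f -> P g -> P (MPrimRec f g)) ->
  (forall f, P f -> P (MMu f)) -> forall f, P f.
Proof.
move=> Pzero Psucc Pproj Pcomp Pprim Pmu; fix IH 1 => -[||i|f gs|f g|f].
- exact: Pzero.
- exact: Psucc.
- exact: Pproj.
- apply: Pcomp (IH f) _; elim: gs => [|g gs IHgs] h; first by case.
  by case=> [<-|]; [exact: IH g | exact: IHgs].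
- exact: Pprim (IH f) (IH g).
- exact: Pmu (IH f).
Qed.

(* A derivation for [MPrimRec] only gives its last value, whereas the loop of
   the compiled code needs all of them. *)
Lemma computes_primrec_values f g m xs y :
  computes (MPrimRec f g) (m :: xs) y ->
  exists v : nat -> nat, [/\ computes f xs (v 0),
    forall i, i < m -> computes g [:: i, v i & xs] (v i.+1) & v m = y].
Proof.
elim: m y => [|m IH] y c; inversion c as [| | | |f' g' xs' y' cf|
    f' g' m' xs' y' z cm cg|]; subst; first by exists (fun=> y).
have [v [v0 vS vm]] := IH _ cm; exists (fun i => if i <= m then v i else y).
split=> // [i|]; last by rewrite ltnn.
rewrite ltnS; case: ltngtP => // [im _|-> _]; first exact: vS.
by rewrite vm.
Qed.

Lemma compiled_computes f xs y : computes f xs y -> compiled f xs y.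
Proof.
elim/murec_nested_ind: f xs y => [||i|f gs IHf IHgs|f g IHf IHg|f IHf] xs y c.
- by inversion c; subst; apply: compiled_zero.
- by inversion c; subst; apply: compiled_succ.
- by inversion c; subst; apply: compiled_proj.
- inversion c; subst; apply: compiled_comp; eauto.
- case: xs c => [|m xs] c; first by inversion c.
  have [v [v0 vS <-]] := computes_primrec_values c.
  by apply: compiled_primrec; eauto.
- inversion c as [| | | | | |f' xs' m v f_lt f_m]; subst.
  by apply: compiled_mu (v) _ _; eauto.
Qed.

(** * Queue machines *)

(* In state [src], pop [pop] from the front of the queue, push [push] at its
   back and go to state [tgt]; [None] stands for no operation. *)
Record rule (Q S : Type) := Rule {
  src : Q;
  pop : option S;
  push : option S;
  tgt : Q }.

Definition rule_tuple Q S (r : rule Q S) := (src r, pop r, push r, tgt r).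

Lemma rule_tupleK Q S :
  cancel (@rule_tuple Q S) (fun t => Rule t.1.1.1 t.1.1.2 t.1.2 t.2).
Proof. by case. Qed.

HB.instance Definition _ (Q S : eqType) :=
  Equality.copy (rule Q S) (can_type (@rule_tupleK Q S)).

Section QueueMachines.
Variables Q S : eqType.
Implicit Types (D : seq (rule Q S)) (c d : Q * seq S).

Definition queue_step D c d := exists2 r, r \in D &
  [/\ src r = c.1, tgt r = d.1 & exists2 w, c.2 = seq_of_opt (pop r) ++ w &
      d.2 = w ++ seq_of_opt (push r)].

Definition reaches D := clos_refl_trans _ (queue_step D).

Lemma queue_step_rule D r w : r \in D -> queue_step D
  (src r, seq_of_opt (pop r) ++ w) (tgt r, w ++ seq_of_opt (push r)).
Proof. by move=> rD; exists r => //; split=> //; exists w. Qed.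

Definition stuck D c := forall d, ~ queue_step D c d.

Lemma stuck_unique D (I : Q * seq S -> Prop) :
  (forall c d, I c -> queue_step D c d -> I d) ->
  (forall c d d', I c -> queue_step D c d -> queue_step D c d' -> d = d') ->
  forall c d d', I c -> reaches D c d -> stuck D d -> reaches D c d' ->
  stuck D d' -> d = d'.
Proof.
move=> I_step det c d d' Ic cd stuck_d cd' stuck_d'.
have {}cd := clos_rt_rt1n _ _ _ _ cd.
elim: cd Ic stuck_d cd' => {c d} [c|c e d ce _ IH] Ic stuck_d cd'.
  by case: (clos_rt_rt1n _ _ _ _ cd') => // e d'' /stuck_d.
have {}cd' := clos_rt_rt1n _ _ _ _ cd'.
inversion cd' as [|e' d'' ce' ed']; subst; first by case: (stuck_d' _ ce).
have eE := det _ _ _ Ic ce ce'; rewrite -eE in ed'.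
by apply: IH => //; [exact: I_step ce | exact: clos_rt1n_rt].
Qed.

End QueueMachines.

(** * Compiling loop programs to queue machines *)

(* [IDec r nz z] decrements [r] and jumps to [nz], or jumps to [z] if [r] is
   zero. *)
Inductive instr := IInc of nat | IDec of nat & nat & nat | IJmp of nat.

Fixpoint flatten_com (c : com) (off : nat) : seq instr :=
  match c with
  | Skip => [::]
  | Inc r => [:: IInc r]
  | Seq c1 c2 =>
      let p := flatten_com c1 off in p ++ flatten_com c2 (off + size p)
  | Loop r c =>
      let p := flatten_com c off.+1 in
      IDec r off.+1 (off + size p).+2 :: rcons p (IJmp off)
  end.

(* The load phase brings the input to register 0. In state [At pc met] the
   machine executes instruction [pc], and [met] tells whether the marker has
   been seen since this instruction started. *)
Inductive control := LoadStart | LoadTour | LoadTurn | At of nat & bool.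

Definition running q := if q is At _ _ then true else false.

Definition control_code q : nat * nat := match q with
  | LoadStart => (0, 0) | LoadTour => (0, 1) | LoadTurn => (0, 2)
  | At pc met => (pc.+1, nat_of_bool met) end.

Lemma control_code_inj : injective control_code.
Proof. by case=> [|||pc []] [|||pc' []] //= [->]. Qed.

HB.instance Definition _ := Equality.copy control (inj_type control_code_inj).

(* The queue holds one marker and, for each register [r], as many tokens [r] as
   the register contains, in any order. *)
Inductive symbol := Marker | Token of nat.

Definition symbol_code x := if x is Token r then r.+1 else 0.

Lemma symbol_code_inj : injective symbol_code.
Proof. by case=> [|r] [|r'] //= [->]. Qed.

HB.instance Definition _ := Equality.copy symbol (inj_type symbol_code_inj).

Definition symbols K := Marker :: map Token (iota 0 K).

Lemma Token_symbols r K : (Token r \in symbols K) = (r < K).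
Proof. by rewrite in_cons mem_map => [|x y [->] //]; rewrite mem_iota. Qed.

(* The queue rotates until the token [r] comes, or the marker comes again. *)
Definition dec_rule pc r nz z met x : rule control symbol :=
  if x == Token r then Rule (At pc met) (Some x) None (At nz false)
  else Rule (At pc met) (Some x) (Some x)
    (if x != Marker then At pc met else if met then At z false else At pc true).

Lemma src_dec_rule pc r nz z met x : src (dec_rule pc r nz z met x) = At pc met.
Proof. by rewrite /dec_rule; case: ifP. Qed.

Lemma pop_dec_rule pc r nz z met x : pop (dec_rule pc r nz z met x) = Some x.
Proof. by rewrite /dec_rule; case: ifP. Qed.

Definition instr_rules K pc i : seq (rule control symbol) :=
  match i with
  | IInc r => [:: Rule (At pc false) None (Some (Token r)) (At pc.+1 false)]
  | IJmp l => [:: Rule (At pc false) None None (At l false)]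
  | IDec r nz z =>
      [seq dec_rule pc r nz z met x | met <- [:: false; true], x <- symbols K]
  end.

Lemma dec_rulesP K pc r nz z e : e \in instr_rules K pc (IDec r nz z) ->
  exists met x, e = dec_rule pc r nz z met x.
Proof. by case/allpairsP => -[met x] [_ _ ->]; exists met, x. Qed.

Definition instr_reg i :=
  match i with IInc r | IDec r _ _ => r | IJmp _ => 0 end.

Definition reg_bound (p : seq instr) := (\max_(i <- p) instr_reg i).+1.

Definition prog_rules (p : seq instr) :=
  flatten [seq instr_rules (reg_bound p) pc (nth (IJmp 0) p pc)
          | pc <- iota 0 (size p)].

Definition load_end := Rule LoadTour (Some Marker) (Some Marker) (At 0 false).
Definition load_first := Rule LoadStart None (Some Marker) LoadTurn.
Definition load_skip :=
  Rule LoadTour (Some (Token 0)) (Some (Token 0)) LoadTour.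
Definition load_round := Rule LoadTour (Some Marker) (Some Marker) LoadTurn.
Definition load_token := Rule LoadTurn None (Some (Token 0)) LoadTour.

(* The load phase starts with the marker alone and adds one token each time the
   marker has gone round the queue. *)
Definition load_rules :=
  [:: load_end; load_first; load_skip; load_round; load_token].

Definition machine p := load_rules ++ prog_rules p.

Definition represents K (w : seq symbol) (s : store) :=
  [/\ count_mem Marker w = 1, forall r, count_mem (Token r) w = s r &
      all (mem (symbols K)) w].

Lemma represents_perm K w w' s :
  perm_eq w w' -> represents K w s -> represents K w' s.
Proof.
move=> /[dup] pw /permP cw [cM cT]; rewrite (perm_all _ pw); split=> //.
  by rewrite -cw.
by move=> r; rewrite -cw.
Qed.

Lemma represents_marker K w s : represents K w s -> exists w1 w2,
  [/\ w = w1 ++ Marker :: w2, Marker \notin w1 & Marker \notin w2].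
Proof.
case=> cM _ _; have Mw : Marker \in w by rewrite -has_pred1 has_count cM.
case/splitPr: Mw cM => w1 w2; rewrite count_cat /= addnCA add1n => -[/eqP].
rewrite addn_eq0 => /andP[/eqP/count_memPn w1M /eqP/count_memPn w2M].
by exists w1, w2.
Qed.

Lemma represents_pop K w1 w2 s r m : s r = m.+1 ->
  represents K (w1 ++ Token r :: w2) s -> represents K (w2 ++ w1) (upd s r m).
Proof.
move=> sr [cM cT]; rewrite all_cat /= => /and3P[a1 _ a2]; split.
- by move: cM; rewrite !count_cat /= add0n addnC.
- move=> x; have := cT x; rewrite !count_cat /= /upd eq_sym.
  by rewrite -[Token x == _]/(x == r); case: eqP => [->|_]; rewrite ?sr; lia.
- by rewrite all_cat a1 a2.
Qed.

Section Simulation.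
Variable p : seq instr.
Let K := reg_bound p.
Let D := machine p.

Lemma step_instr pc i r w : pc < size p -> nth (IJmp 0) p pc = i ->
  r \in instr_rules K pc i -> queue_step D
    (src r, seq_of_opt (pop r) ++ w) (tgt r, w ++ seq_of_opt (push r)).
Proof.
move=> pc_p <- r_i; apply: queue_step_rule; rewrite mem_cat; apply/orP; right.
by apply/flatten_mapP; exists pc; rewrite ?mem_iota.
Qed.

Lemma reach_inc pc r w s : pc < size p -> nth (IJmp 0) p pc = IInc r ->
  represents K w s ->
  exists2 w', reaches D (At pc false, w) (At pc.+1 false, w') &
              represents K w' (upd s r (s r).+1).
Proof.
move=> pc_p pc_r [cM cT wK]; exists (rcons w (Token r)).
  have := step_instr w pc_p pc_r (mem_head _ _).
  by rewrite /= cats1; apply: rt_step.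
have rK : r < K.
  rewrite ltnS -[r]/(instr_reg (IInc r)) -pc_r (big_nth (IJmp 0)) big_mkord.
  exact: (leq_bigmax (Ordinal pc_p)).
split; first by rewrite -cats1 count_cat cM.
  move=> x; rewrite -cats1 count_cat cT /= addn0 /upd eq_sym.
  rewrite -[Token x == _]/(x == r).
  by case: eqP => [->|_]; rewrite ?addn1 ?addn0.
by rewrite all_rcons wK andbT /= Token_symbols.
Qed.

Lemma reach_jmp pc l w : pc < size p -> nth (IJmp 0) p pc = IJmp l ->
  reaches D (At pc false, w) (At l false, w).
Proof.
move=> pc_p pc_l; have := step_instr w pc_p pc_l (mem_head _ _).
by rewrite /= cats0; apply: rt_step.
Qed.

Section Decrement.
Variables (pc r nz z : nat).
Hypotheses (pc_p : pc < size p) (pc_dec : nth (IJmp 0) p pc = IDec r nz z).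

Lemma step_dec met x w : x \in symbols K -> let e := dec_rule pc r nz z met x in
  queue_step D (At pc met, x :: w) (tgt e, w ++ seq_of_opt (push e)).
Proof.
move=> xK e; have -> : (At pc met, x :: w) = (src e, seq_of_opt (pop e) ++ w).
  by rewrite /e src_dec_rule pop_dec_rule.
apply: step_instr pc_p pc_dec _.
by apply: allpairs_f xK; case: (met); rewrite !inE.
Qed.

Lemma reach_rotate met w1 w2 : all (mem (symbols K)) w1 -> Marker \notin w1 ->
  Token r \notin w1 -> reaches D (At pc met, w1 ++ w2) (At pc met, w2 ++ w1).
Proof.
elim: w1 w2 => [|x w1 IH] w2; first by rewrite cats0 => *; apply: rt_refl.
rewrite /= !in_cons !negb_or => /andP[xK w1K] /andP[xM w1M] /andP[xr w1r].
have := step_dec met (w1 ++ w2) xK.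
rewrite /dec_rule eq_sym (negbTE xr) eq_sym xM /= -catA cats1 => step.
by apply: rt_trans (rt_step _ _ _ _ step) _; rewrite -cat_rcons; apply: IH.
Qed.

Lemma reach_token met w1 w2 : all (mem (symbols K)) (w1 ++ Token r :: w2) ->
  Marker \notin w1 -> Token r \notin w1 ->
  reaches D (At pc met, w1 ++ Token r :: w2) (At nz false, w2 ++ w1).
Proof.
rewrite all_cat /= => /and3P[w1K rK _] w1M w1r.
apply: rt_trans (reach_rotate _ _ w1K w1M w1r) _.
have := step_dec met (w2 ++ w1) rK.
by rewrite /dec_rule eqxx /= cats0; apply: rt_step.
Qed.

Lemma reach_marker met w1 w2 : all (mem (symbols K)) w1 -> Marker \notin w1 ->
  Token r \notin w1 -> reaches D (At pc met, w1 ++ Marker :: w2)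
    (if met then At z false else At pc true, (w2 ++ w1) ++ [:: Marker]).
Proof.
move=> w1K w1M w1r; apply: rt_trans (reach_rotate _ _ w1K w1M w1r) _.
apply: rt_step; exact: (step_dec met (w2 ++ w1) (mem_head _ _)).
Qed.

Lemma reach_dec_pos w s m : represents K w s -> s r = m.+1 ->
  exists2 w', reaches D (At pc false, w) (At nz false, w') &
              represents K w' (upd s r m).
Proof.
move=> rep sr; have rw : Token r \in w.
  by rewrite -has_pred1 has_count; case: rep => _ ->; rewrite sr.
have first_token v : Token r \in v -> exists v1 v2,
    v = v1 ++ Token r :: v2 /\ Token r \notin v1.
  rewrite -has_pred1 => /split_find[x v1 v2 /eqP-> v1r].
  by exists v1, v2; rewrite cat_rcons -has_pred1.
have [w1 [w2 [wE w1M w2M]]] := represents_marker rep.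
have [/first_token[v1 [v2 [w1E v1r]]]|w1r] := boolP (Token r \in w1).
  exists ((v2 ++ Marker :: w2) ++ v1).
    rewrite wE w1E -catA; apply: reach_token => //.
      by case: rep => _ _; rewrite wE w1E -catA.
    by move: w1M; rewrite w1E mem_cat negb_or => /andP[].
  by apply: represents_pop sr _; rewrite wE w1E -catA in rep.
have /first_token[v1 [v2 [w2E v1r]]] : Token r \in w2.
  by move: rw; rewrite wE mem_cat in_cons (negbTE w1r).
have w21E : (w2 ++ w1) ++ [:: Marker] =
    v1 ++ Token r :: (v2 ++ w1 ++ [:: Marker]).
  by rewrite w2E -!catA.
have {}rep : represents K (v1 ++ Token r :: (v2 ++ w1 ++ [:: Marker])) s.
  rewrite -w21E; apply: represents_perm rep.
  by rewrite wE perm_catC cats1 perm_sym perm_rcons.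
exists ((v2 ++ w1 ++ [:: Marker]) ++ v1); last exact: represents_pop sr rep.
have w1K : all (mem (symbols K)) w1.
  by case: rep => _ _; rewrite !all_cat /= !all_cat => /and5P[].
rewrite wE; apply: rt_trans (reach_marker _ w2 w1K w1M w1r) _ => /=.
rewrite w21E; apply: reach_token => //; first by case: rep.
by move: w2M; rewrite w2E mem_cat negb_or => /andP[].
Qed.

Lemma reach_dec_zero w s : represents K w s -> s r = 0 ->
  exists2 w', reaches D (At pc false, w) (At z false, w') & represents K w' s.
Proof.
move=> rep sr; have nr : Token r \notin w.
  by apply/count_memPn; case: rep => _ ->.
have [w1 [w2 [wE w1M w2M]]] := represents_marker rep.
have [w1K w2K] : all (mem (symbols K)) w1 /\ all (mem (symbols K)) w2.
  by case: rep => _ _; rewrite wE all_cat /= => /andP[].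
exists ((w2 ++ w1) ++ [:: Marker]); last first.
  by apply: represents_perm rep; rewrite wE perm_catC cats1 perm_sym perm_rcons.
move: nr; rewrite wE mem_cat in_cons !negb_or => /and3P[w1r _ w2r].
apply: rt_trans (reach_marker _ w2 w1K w1M w1r) _ => /=.
apply: (@reach_marker true (w2 ++ w1) [::]).
- by rewrite all_cat w2K.
- by rewrite mem_cat negb_or w2M.
- by rewrite mem_cat negb_or w2r.
Qed.

End Decrement.

Definition code_at off q := exists p1 p2, p = p1 ++ q ++ p2 /\ size p1 = off.

Lemma code_at_cat off q1 q2 : code_at off (q1 ++ q2) ->
  code_at off q1 /\ code_at (off + size q1) q2.
Proof.
move=> [p1 [p2 [pE <-]]]; split.
  by exists p1, (q2 ++ p2); rewrite pE -!catA.
by exists (p1 ++ q1), p2; rewrite pE -!catA size_cat.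
Qed.

Lemma code_at_cons off i q : code_at off (i :: q) ->
  off < size p /\ nth (IJmp 0) p off = i.
Proof.
move=> [p1 [p2 [pE <-]]]; rewrite pE nth_cat ltnn subnn !size_cat /=.
by split=> //; lia.
Qed.

Lemma reach_exec c s s' off w :
  exec c s s' -> code_at off (flatten_com c off) ->
  represents K w s ->
  exists2 w', reaches D (At off false, w)
      (At (off + size (flatten_com c off)) false, w') & represents K w' s'.
Proof.
move=> ex; elim: ex off w => {c s s'} /=.
- by move=> s off w _ rep; exists w; rewrite ?addn0 //; apply: rt_refl.
- move=> r s off w /code_at_cons[off_p off_r]; rewrite addn1.
  exact: reach_inc.
- move=> c1 c2 s1 s2 s3 _ IH1 _ IH2 off w /code_at_cat[code1 code2] rep.
  have [w1 run1 rep1] := IH1 _ _ code1 rep.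
  have [w2 run2 rep2] := IH2 _ _ code2 rep1.
  by exists w2 => //; apply: rt_trans run1 _; rewrite size_cat addnA.
- move=> r c s sr off w /code_at_cons[off_p off_r] rep.
  by have := reach_dec_zero off_p off_r rep sr; rewrite size_rcons !addnS.
- move=> r c s1 s2 s3 m sr _ IHbody _ IHloop off w code rep.
  have [off_p off_r] := code_at_cons code.
  have [w1 run1 rep1] := reach_dec_pos off_p off_r rep sr.
  move: (code); rewrite -cat1s -cats1 => /code_at_cat[_] /code_at_cat[].
  rewrite /= addn1 => body /code_at_cons[jmp_p jmp_off].
  have [w2 run2 rep2] := IHbody _ _ body rep1.
  have [w3 run3 rep3] := IHloop off w2 code rep2; exists w3 => //.
  apply: rt_trans run1 _; apply: rt_trans run2 _.
  by apply: rt_trans (reach_jmp _ jmp_p jmp_off) _; rewrite cats1.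
Qed.

Lemma instr_rule_At pc i r : r \in instr_rules K pc i ->
  (exists met, src r = At pc met) /\ running (tgt r).
Proof.
case: i => [x|x nz z|l].
- by rewrite inE => /eqP->; split=> //; eexists.
- case/dec_rulesP => met [y ->]; split.
    by exists met; apply: src_dec_rule.
  by rewrite /dec_rule; do 3?[case: ifP => // _].
- by rewrite inE => /eqP->; split=> //; eexists.
Qed.

Lemma machine_ruleP r pc met : r \in D -> src r = At pc met ->
  [/\ pc < size p, r \in instr_rules K pc (nth (IJmp 0) p pc) &
      running (tgt r)].
Proof.
rewrite mem_cat => /orP[|/flatten_mapP[pc' pc'_p r_pc']].
  by rewrite !inE => /or4P[|||/orP[]] /eqP->.
have [[met' ->] r_running] := instr_rule_At r_pc'.
by case=> <- _; split=> //; rewrite mem_iota in pc'_p.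
Qed.

Lemma running_step c d : running c.1 -> queue_step D c d -> running d.1.
Proof.
case: c => -[|||pc met] w //= _ [r rD [/(machine_ruleP rD)[_ _ r_running] <-]].
by [].
Qed.

Lemma stuck_end pc met w : size p <= pc -> stuck D (At pc met, w).
Proof.
move=> p_pc d [r rD [/= srcE _ _]].
by have [] := machine_ruleP rD srcE; lia.
Qed.

Lemma machine_det c d d' : running c.1 ->
  queue_step D c d -> queue_step D c d' -> d = d'.
Proof.
case: c d d' => -[|||pc met] w [q1 w1] [q1' w1'] // _.
move=> [r rD [/= srcE tgtE [v wE w1E]]] [r' rD' [/= srcE' tgtE' [v' wE' w1E']]].
suff rE : r = r'.
  subst r'; move: wE'; rewrite {1}wE.
  move=> /(congr1 (drop (size (seq_of_opt (pop r))))).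
  by rewrite !drop_size_cat // => vE; rewrite w1E w1E' vE -tgtE -tgtE'.
have [_ r_pc _] := machine_ruleP rD srcE.
have [_ r_pc' _] := machine_ruleP rD' srcE'.
move: r_pc r_pc'; case: (nth _ _ _) => [y|y nz z|l].
- by rewrite !inE => /eqP-> /eqP->.
- case/dec_rulesP => b [x rE] /dec_rulesP[b' [x' rE']].
  suff [bE xE] : b = b' /\ x = x' by rewrite rE rE' bE xE.
  move: srcE srcE' wE wE'; rewrite rE rE' !src_dec_rule !pop_dec_rule.
  by move=> [->] [->] -> [->].
- by rewrite !inE => /eqP-> /eqP->.
Qed.

End Simulation.

(** * Running a decision procedure on a queue machine *)

(* Falls off the end of the program if the result is positive, and jumps beyond
   the end otherwise. *)
Definition decision_prog g :=
  let q := flatten_com (compile g [:: 0] 1 2) 0 in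
  rcons q (IDec 1 (size q).+1 (size q).+2).

Definition halt_state (p : seq instr) := At (size p) false.

Definition input_store u : store := upd (fun=> 0) 0 u.

Section Decision.
Variables (g : murec) (u : nat) (w : seq symbol).
Let p := decision_prog g.
Let D := machine p.
Hypothesis w_u : represents (reg_bound p) w (input_store u).

Lemma reach_decision y : computes g [:: u] y -> exists w1,
  reaches D (At 0 false, w) (At (size p).-1 false, w1) /\
  represents (reg_bound p) w1 (upd (input_store u) 1 y).
Proof.
move=> /compiled_computes cg; set c := compile g [:: 0] 1 2.
have run : exec c (input_store u) (upd (input_store u) 1 y).
  by apply: cg => //; split=> // -[|[|r]].
have code : code_at p 0 (flatten_com c 0).
  by exists [::]; eexists; split; first exact: esym (cats1 _ _).
have [w1 run1 rep1] := reach_exec run code w_u; exists w1.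
by rewrite /p /decision_prog size_rcons.
Qed.

Lemma decision_prog_last : (size p).-1 < size p /\
  nth (IJmp 0) p (size p).-1 = IDec 1 (size p) (size p).+1.
Proof.
rewrite /p /decision_prog size_rcons /=; split=> //.
by rewrite nth_rcons ltnn eqxx.
Qed.

Lemma decision_halts : computes g [:: u] 1 ->
  exists w', reaches D (At 0 false, w) (halt_state p, w').
Proof.
move=> /reach_decision[w1 [run1 rep1]].
have [last_p last_dec] := decision_prog_last.
have [w2 run2 _] := reach_dec_pos last_p last_dec rep1 erefl.
by exists w2; apply: rt_trans run1 run2.
Qed.

Lemma decision_never_halts w' : computes g [:: u] 0 ->
  ~ reaches D (At 0 false, w) (halt_state p, w').
Proof.
move=> /reach_decision[w1 [run1 rep1]] run'.
have [last_p last_dec] := decision_prog_last.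
have [w2 run2 _] := reach_dec_zero last_p last_dec rep1 erefl.
suff [pE _] : (At (size p).+1 false, w2) = (halt_state p, w') by lia.
apply: (stuck_unique (I := fun c => running c.1) (c := (At 0 false, w))
  (@running_step p) (@machine_det p) isT _ _ run').
- exact: rt_trans run1 run2.
- by apply: stuck_end; apply: leqnSn.
- by apply: stuck_end; apply: leqnn.
Qed.

End Decision.

Lemma load_reaches p u : 0 < u -> reaches (machine p)
  (LoadStart, [::]) (LoadTour, Marker :: nseq u (Token 0)).
Proof.
have step r v : r \in load_rules -> reaches (machine p)
    (src r, seq_of_opt (pop r) ++ v) (tgt r, v ++ seq_of_opt (push r)).
  by move=> r_load; apply/rt_step/queue_step_rule; rewrite mem_cat r_load.
have skip m v : reaches (machine p)
    (LoadTour, nseq m (Token 0) ++ v) (LoadTour, v ++ nseq m (Token 0)).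
  elim: m v => [|m IH] v; first by rewrite cats0; apply: rt_refl.
  apply: rt_trans (step load_skip _ _) _; first by rewrite !inE eqxx !orbT.
  by rewrite -catA /= cats1 -cat_rcons; apply: IH.
case: u => // u _; elim: u => [|u IH].
  apply: rt_trans (step load_first [::] _) _; first by rewrite !inE eqxx !orbT.
  by apply: (step load_token [:: Marker]); rewrite !inE eqxx !orbT.
apply: rt_trans IH _.
apply: rt_trans (step load_round (nseq u.+1 (Token 0)) _) _.
  by rewrite !inE eqxx !orbT.
apply: rt_trans (step load_token (nseq u.+1 (Token 0) ++ [:: Marker]) _) _.
  by rewrite !inE eqxx !orbT.
by rewrite -catA; apply: skip.
Qed.

(** * Timed runs of queue machines *)

Section Events.
Local Open Scope ring_scope.
Variable R : realType.

(* An event is a date and a letter. *)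
Definition event := (R * nat)%type.

Definition increasing (T : R) (u : seq event) := path <%R T (unzip1 u).

Lemma increasing_cat T u1 u2 : increasing T (u1 ++ u2) =
  increasing T u1 && increasing (last T (unzip1 u1)) u2.
Proof. by rewrite /increasing /unzip1 map_cat cat_path. Qed.

Lemma increasing_gt T u p : increasing T u -> p \in u -> T < p.1.
Proof.
rewrite /increasing lt_path_sortedE => /andP[/allP T_lt _] pu; apply: T_lt.
exact: map_f.
Qed.

Lemma increasing_split T u1 p u2 : increasing T (u1 ++ p :: u2) ->
  all (fun p' : event => p'.1 < p.1) u1 /\
  all (fun p' : event => p.1 < p'.1) u2.
Proof.
rewrite /increasing lt_path_pairwise /unzip1 map_cat /= pairwise_cat /=.
move=> /and5P[_ /allrelP u1p _ pu2 _]; split; last by rewrite all_map in pu2.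
by apply/allP => p' p'u1; apply: u1p; rewrite ?map_f ?mem_head.
Qed.

Lemma increasing_last T u p :
  increasing T u -> p \in u -> p.1 <= last T (unzip1 u).
Proof.
case/lastP: u => // u p'; rewrite -cats1 => /increasing_split[/allP lt_p' _].
rewrite /unzip1 map_cat last_cat /= mem_cat inE.
by move=> /orP[/lt_p'/ltW|/eqP->].
Qed.

Lemma last_ge0 u : increasing 0 u -> 0 <= last 0 (unzip1 u).
Proof.
case/lastP: u => // u p /increasing_gt -/(_ p); rewrite mem_rcons mem_head.
by rewrite /unzip1 map_rcons last_rcons => /(_ isT)/ltW.
Qed.

Lemma increasing_catI T u1 u2 : increasing T u1 -> increasing T u2 ->
  (forall p p', p \in u1 -> p' \in u2 -> p.1 < p'.1) -> increasing T (u1 ++ u2).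
Proof.
rewrite /increasing !lt_path_pairwise /unzip1 map_cat /= pairwise_cat all_cat.
move=> /andP[-> ->] /andP[-> ->] lt12; rewrite !andbT.
by apply/allrelP => _ _ /mapP[p pu ->] /mapP[p' pu' ->]; apply: lt12.
Qed.

Lemma increasing_partition T u t : increasing T u -> exists L M, [/\ u = L ++ M,
  all (fun p : event => p.1 < t) L & all (fun p : event => t <= p.1) M].
Proof.
elim: u T => [|p u IH] T; first by exists [::], [::].
move=> inc; have [_ pu] := @increasing_split T [::] p u inc.
have [lt|le] := ltP p.1 t; last first.
  exists [::], (p :: u); split=> //=; rewrite le; apply: sub_all pu => p' /ltW.
  exact: le_trans.
have [L [M [-> L_lt M_ge]]] := IH _ (proj2 (andP inc)).
by exists (p :: L), M; rewrite /= lt.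
Qed.

End Events.

Section TimedRuns.
Local Open Scope ring_scope.
Variables (R : realType) (Q S : eqType) (r0 : rule Q S) (D : seq (rule Q S)).
Implicit Types (t T : R) (u v : seq (event R)) (p : event R) (q : seq (R * S)).

Definition letter_rule a := nth r0 D a.
Local Notation rl := letter_rule.

Definition is_word u := all (fun p => p.2 < size D)%N u.

(* A state, the date of the last event, and the queue with the dates at which
   its symbols were pushed. *)
Definition timed_config := (Q * R * seq (R * S))%type.
Implicit Types c d e : timed_config.

Definition stamp t (o : option S) := [seq (t, x) | x <- seq_of_opt o].

(* A symbol pushed at date [t] is popped at date [t + 1]. *)
Definition timed_step c p d :=
  [/\ (p.2 < size D)%N, src (rl p.2) = c.1.1, c.1.2 < p.1 & exists q,
      [/\ c.2 = stamp (p.1 - 1) (pop (rl p.2)) ++ q,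
          all (fun x => p.1 < x.1 + 1) q &
          d = (tgt (rl p.2), p.1, q ++ stamp p.1 (push (rl p.2)))]].

Fixpoint timed_run c u d : Prop :=
  if u is p :: u' then exists2 c', timed_step c p c' & timed_run c' u' d
  else c = d.

Lemma timed_run_cat c u1 u2 e : timed_run c (u1 ++ u2) e <->
  exists2 d, timed_run c u1 d & timed_run d u2 e.
Proof.
elim: u1 c => [|p u1 IH] c /=; first by split=> [run|[d ->] //]; exists c.
split=> [[c' cc' /IH[d run1 run2]]|[d [c' cc' run1] run2]].
  by exists d => //; exists c'.
by exists c' => //; apply/IH; exists d.
Qed.

Lemma timed_run_increasing c u d : timed_run c u d -> increasing c.1.2 u.
Proof.
elim: u c => //= p u IH c [c' [_ _ lt [q [_ _ c'E]]] /IH].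
by rewrite c'E /increasing /= lt.
Qed.

Lemma timed_run_is_word c u d : timed_run c u d -> is_word u.
Proof. by elim: u c => //= p u IH c [c' [-> _ _ _] /IH]. Qed.

Lemma mem_stamp (x : R * S) t o :
  (x \in stamp t o) = (o == Some x.2) && (x.1 == t).
Proof.
case: o x => [y|] [t' x] //=; rewrite inE xpair_eqE andbC /=.
by congr (_ && _); rewrite eq_sym.
Qed.

Lemma timed_run_popped c v p u e : timed_run c (v ++ p :: u) e ->
  pop (rl p.2) != None ->
  (exists2 x, x \in c.2 & x.1 = p.1 - 1) \/
  (exists2 p', p' \in v & p'.1 = p.1 - 1 /\ push (rl p'.2) != None).
Proof.
elim: v c => [|p' v IH] c /= [c' [_ _ _ [q [cE _ c'E]]] run] p_pop.
  left; case: (pop (rl p.2)) p_pop cE => // x _ ->; exists (p.1 - 1, x) => //.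
  by rewrite mem_head.
have [[x]|[p2 p2v p2_push]] := IH _ run p_pop; last first.
  by right; exists p2; rewrite // inE p2v orbT.
rewrite c'E mem_cat mem_stamp => /orP[xq xE|/andP[/eqP push_p' /eqP xE'] xE].
  by left; exists x; rewrite // cE mem_cat xq orbT.
by right; exists p'; rewrite ?mem_head // push_p' -xE -xE'.
Qed.

Lemma timed_run_pushed c v p u e t x : timed_run c (v ++ p :: u) e ->
  (t, x) \in c.2 -> all (fun p' => p'.1 < t + 1) v ->
  p.1 <= t + 1 /\ (p.1 = t + 1 -> pop (rl p.2) = Some x).
Proof.
elim: v c => [|p' v IH] c /= [c' [_ _ _ [q [cE lt_q c'E]]] run].
  rewrite cE mem_cat mem_stamp.
  case/orP=> [/andP[/eqP-> /eqP/= ->] _|/(allP lt_q)/= lt _].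
    by rewrite subrK.
  by split=> [|pE]; [exact: ltW | rewrite pE ltxx in lt].
rewrite cE mem_cat => tx /andP[p't vt]; apply: IH run _ vt; rewrite c'E mem_cat.
case/orP: tx => [|->//]; rewrite mem_stamp => /andP[_ /eqP/= tE].
by rewrite tE subrK ltxx in p't.
Qed.

Section Faults.
Variables (start halt : Q) (mark delay : nat).

Definition on_time u := forall t a v t' u2,
  u = (t, a) :: v ++ (t', mark) :: u2 -> t' = t + delay%:R.

Definition codes_run u := [/\ u != [::], on_time u &
  exists T q, timed_run (start, 0, [::]) u (halt, T, q)].

(* Where a word that does not code a run goes wrong; each case is recognized
   with two clocks. *)
Inductive faulty : seq (event R) -> Prop :=
  | faulty_nil : faulty [::]
  | faulty_start p u : src (rl p.2) != start -> faulty (p :: u)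
  | faulty_halt u p : tgt (rl p.2) != halt -> faulty (rcons u p)
  | faulty_state u p p' u' : tgt (rl p.2) != src (rl p'.2) ->
      faulty (u ++ [:: p, p' & u'])
  | faulty_push u p v p' u' : all (fun p2 => p2.1 < p.1 + 1) v ->
      (p'.1 = p.1 + 1 /\ pop (rl p'.2) != push (rl p.2)) \/
      (p.1 + 1 < p'.1 /\ push (rl p.2) != None) ->
      faulty (u ++ p :: v ++ p' :: u')
  | faulty_pop u p v p' u' : p.1 + 1 < p'.1 ->
      all (fun p2 => p'.1 < p2.1 + 1) v -> pop (rl p'.2) != None ->
      faulty (u ++ p :: v ++ p' :: u')
  | faulty_early_pop v p' u' : all (fun p2 => p'.1 < p2.1 + 1) v ->
      pop (rl p'.2) != None -> faulty (v ++ p' :: u')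
  | faulty_mark p v t' u' : t' != p.1 + delay%:R ->
      faulty (p :: v ++ (t', mark) :: u').

Lemma run_late_no_push s T u p v p' u' e :
  timed_run (s, T, [::]) (u ++ p :: v ++ p' :: u') e ->
  all (fun p2 => p2.1 < p.1 + 1) v -> p.1 + 1 < p'.1 -> push (rl p.2) = None.
Proof.
move=> /timed_run_cat[c _ [d [_ _ _ [q [_ _ dE]]] run]] v_lt late.
case push_p: (push (rl p.2)) => [x|//].
have [|le _] := timed_run_pushed run (t := p.1) (x := x) _ v_lt.
  by rewrite dE mem_cat mem_stamp push_p !eqxx orbT.
by rewrite leNgt late in le.
Qed.

Lemma run_pop_pushed s T u p' u' e : timed_run (s, T, [::]) (u ++ p' :: u') e ->
  pop (rl p'.2) != None ->
  exists2 p2, p2 \in u & p2.1 = p'.1 - 1 /\ push (rl p2.2) != None.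
Proof. by move=> run /(timed_run_popped run)[[]|]. Qed.

Lemma run_pop_matches s T u p v p' u' e :
  timed_run (s, T, [::]) (u ++ p :: v ++ p' :: u') e ->
  all (fun p2 => p2.1 < p.1 + 1) v -> p'.1 = p.1 + 1 ->
  pop (rl p'.2) = push (rl p.2).
Proof.
move=> run v_lt p'E.
have [u_lt] := increasing_split (timed_run_increasing run).
rewrite all_cat => /andP[v_gt _].
case push_p: (push (rl p.2)) => [x|].
  move: run => /timed_run_cat[c _ [d [_ _ _ [q [_ _ dE]]] run]].
  have [|_ popE] := timed_run_pushed run (t := p.1) (x := x) _ v_lt.
    by rewrite dE mem_cat mem_stamp push_p !eqxx orbT.
  exact: popE.
apply/eqP/negPn/negP; rewrite -cat_cons catA in run.
move=> /(run_pop_pushed run)[p2].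
rewrite p'E addrK mem_cat inE => /or3P[p2u|/eqP->|p2v] [p2E].
- by have := allP u_lt _ p2u; rewrite p2E ltxx.
- by rewrite push_p.
- by have := allP v_gt _ p2v; rewrite p2E ltxx.
Qed.

Lemma run_gap_no_pop s T u p v p' u' e :
  timed_run (s, T, [::]) (u ++ p :: v ++ p' :: u') e -> p.1 + 1 < p'.1 ->
  all (fun p2 => p'.1 < p2.1 + 1) v -> pop (rl p'.2) = None.
Proof.
move=> run late v_late.
have [u_lt _] := increasing_split (timed_run_increasing run).
apply/eqP/negPn/negP; rewrite -cat_cons catA in run.
move=> /(run_pop_pushed run)[p2]; rewrite mem_cat inE.
by move=> /or3P[/(allP u_lt)/= lt|/eqP->|/(allP v_late)/= lt] [p2E _]; lra.
Qed.

Lemma codes_run_not_faulty u : codes_run u -> ~ faulty u.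
Proof.
move=> [u0 u_on_time [T [q run]]] u_faulty.
case: u_faulty u0 u_on_time run => {u} //.
- by move=> p u /eqP p_src _ _ [c' [_ /p_src]].
- move=> u p /eqP p_tgt _ _; rewrite -cats1 => /timed_run_cat[c _ [d]].
  by case=> _ _ _ [q' [_ _ ->]] [/p_tgt].
- move=> u p p' u' /eqP ne _ _ /timed_run_cat[c _ [d [_ _ _ [q' [_ _ ->]]]]].
  by case=> d' [_ srcE _ _] _; apply: ne.
- move=> u p v p' u' v_lt p'_bad _ _ run.
  case: p'_bad => -[p'E]; last by rewrite (run_late_no_push run).
  by rewrite (run_pop_matches run) // eqxx.
- move=> u p v p' u' late v_late p'_pop _ _ run.
  by rewrite (run_gap_no_pop run) in p'_pop.
- move=> v p' u' v_late p'_pop _ _ /run_pop_pushed/(_ p'_pop)[p2].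
  by move=> /(allP v_late)/= lt [p2E _]; lra.
- by move=> [t a] v t' u' /eqP ne _ /(_ t a v t' u' erefl)/ne.
Qed.

(* The queue at date [T], if no symbol was popped wrongly. *)
Definition pending T u : seq (R * S) :=
  flatten [seq stamp p.1 (push (rl p.2)) | p <- u & T < p.1 + 1].

Lemma pending_cat T u1 u2 : pending T (u1 ++ u2) = pending T u1 ++ pending T u2.
Proof. by rewrite /pending filter_cat map_cat flatten_cat. Qed.

Lemma pending_gt T u : all (fun x => T < x.1 + 1) (pending T u).
Proof.
apply/allP => x /flatten_mapP[p]; rewrite mem_filter => /andP[Tp _].
by rewrite mem_stamp => /andP[_ /eqP ->].
Qed.

Lemma pending_nil T u :
  (forall p, p \in u -> T < p.1 + 1 -> push (rl p.2) = None) ->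
  pending T u = [::].
Proof.
elim: u => // p u IH no_push; rewrite -cat1s pending_cat IH ?cats0; last first.
  by move=> p' p'u; apply: no_push; rewrite inE p'u orbT.
by rewrite /pending /=; case: ifP => //= /no_push ->; rewrite ?mem_head.
Qed.

Lemma pending_all T T' u : all (fun p => T < p.1 + 1) u ->
  all (fun p => T' < p.1 + 1) u -> pending T u = pending T' u.
Proof. by move=> /all_filterP TE /all_filterP T'E; rewrite /pending TE T'E. Qed.

Section FaultlessStep.
Variables (u : seq (event R)) (p : event R) (u' : seq (event R)).
Hypothesis inc : increasing 0 (u ++ p :: u').
Hypothesis faultless : ~ faulty (u ++ p :: u').
Let T := last 0 (unzip1 u).

Let T_lt : T < p.1.
Proof. by move: inc; rewrite increasing_cat => /andP[_ /andP[]]. Qed.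

Let le_T p' : p' \in u -> p'.1 <= T.
Proof.
by apply: increasing_last; move: inc; rewrite increasing_cat => /andP[].
Qed.

Lemma expired_no_push p' : p' \in u -> p'.1 + 1 < p.1 -> T < p'.1 + 1 ->
  push (rl p'.2) = None.
Proof.
move=> p'u lt T_lt'; apply/eqP/negPn/negP => push_p'; apply: faultless.
case/splitPr: p'u le_T => L M le_T'; rewrite -catA.
apply: faulty_push; last by right.
apply/allP => p2 p2M; apply: le_lt_trans T_lt'; apply: le_T'.
by rewrite mem_cat inE p2M !orbT.
Qed.

Lemma gap_no_pop L M : u = L ++ M -> all (fun p' => p'.1 + 1 < p.1) L ->
  all (fun p' => p.1 < p'.1 + 1) M -> pop (rl p.2) = None.
Proof.
move=> uE L_expired M_fresh; apply/eqP/negPn/negP => p_pop; apply: faultless.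
rewrite uE -catA; case/lastP: L L_expired {uE} => [|L p1] L_expired.
  exact: faulty_early_pop.
rewrite cat_rcons; apply: faulty_pop => //.
by move: L_expired; rewrite all_rcons => /andP[].
Qed.

Lemma matching_pop L p1 M : u = L ++ p1 :: M -> p.1 = p1.1 + 1 ->
  pop (rl p.2) = push (rl p1.2).
Proof.
move=> uE pE; apply/eqP/negPn/negP => ne; apply: faultless.
rewrite uE -catA cat_cons; apply: faulty_push; last by left.
apply/allP => p2 p2M; rewrite -pE; apply: le_lt_trans T_lt; apply: le_T.
by rewrite uE mem_cat inE p2M !orbT.
Qed.

Lemma pending_pop :
  pending T u = stamp (p.1 - 1) (pop (rl p.2)) ++ pending p.1 u.
Proof.
have incu : increasing 0 u by move: inc; rewrite increasing_cat => /andP[].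
have [L [M [uE L_expired M_alive]]] := increasing_partition (p.1 - 1) incu.
have {}L_expired : all (fun p' => p'.1 + 1 < p.1) L.
  by apply: sub_all L_expired => p'; lra.
have {}M_alive : all (fun p' => p.1 <= p'.1 + 1) M.
  by apply: sub_all M_alive => p'; lra.
have M_pending : all (fun p' => T < p'.1 + 1) M.
  by apply: sub_all M_alive => p'; have := T_lt; lra.
have L_nil_T : pending T L = [::].
  apply: pending_nil => p' p'L.
  apply: expired_no_push; last exact: (allP L_expired).
  by rewrite uE mem_cat p'L.
have L_nil_p : pending p.1 L = [::].
  by apply: pending_nil => p' /(allP L_expired)/ltW; rewrite leNgt => /negbTE->.
rewrite [in LHS]uE [in RHS]uE !pending_cat L_nil_T L_nil_p /= {L_nil_T L_nil_p}.
have unmatched : all (fun p' => p.1 < p'.1 + 1) M ->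
    pending T M = stamp (p.1 - 1) (pop (rl p.2)) ++ pending p.1 M.
  move=> M_fresh; rewrite (gap_no_pop uE L_expired M_fresh).
  exact: pending_all.
case: M => [|p1 M] in uE M_alive M_pending unmatched *; first exact: unmatched.
have M_fresh : all (fun p' => p.1 < p'.1 + 1) M.
  move: incu; rewrite uE => /increasing_split[_]; apply: sub_all => p2.
  by case/andP: M_alive; lra.
have [pE|ne] := eqVneq p.1 (p1.1 + 1); last first.
  apply: unmatched; rewrite /= M_fresh andbT lt_neqAle ne.
  by case/andP: M_alive.
case/andP: M_pending => p1T M_pending.
rewrite (matching_pop uE pE) -cat1s !pending_cat.
rewrite (pending_all M_pending M_fresh) {1 3}/pending /= p1T pE ltxx /=.
by rewrite cats0 addrK.
Qed.

End FaultlessStep.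

Lemma not_faulty_codes_run u : increasing 0 u -> is_word u -> ~ faulty u ->
  codes_run u.
Proof.
move=> inc uD faultless; split.
- by apply/eqP => u0; apply: faultless; rewrite u0; apply: faulty_nil.
- move=> t a v t' u' uE; apply/eqP/negPn/negP => ne; apply: faultless.
  by rewrite uE; apply: faulty_mark.
have run_from u2 u1 : u = u1 ++ u2 -> exists T q, timed_run
    (last start [seq tgt (rl p.2) | p <- u1], last 0 (unzip1 u1),
     pending (last 0 (unzip1 u1)) u1) u2 (halt, T, q).
  elim: u2 u1 => [|p u2 IH] u1 uE.
    exists (last 0 (unzip1 u1)), (pending (last 0 (unzip1 u1)) u1) => /=.
    rewrite cats0 in uE; subst u.
    case/lastP: u1 faultless {inc uD} => [[]|u1 p faultless].
      exact: faulty_nil.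
    rewrite map_rcons last_rcons; congr (_, _, _); apply/eqP/negPn/negP => ne.
    by apply: faultless; apply: faulty_halt.
  have [T [q run]] := IH (rcons u1 p) (etrans uE (esym (cat_rcons _ _ _))).
  exists T, q => /=; eexists; last exact: run; split=> /=.
  - by have /(allP uD) : p \in u by rewrite uE mem_cat mem_head orbT.
  - apply/eqP/negPn/negP => ne; apply: faultless; rewrite uE.
    case/lastP: u1 ne {IH uE run} => [|u1 p1]; first exact: faulty_start.
    by rewrite map_rcons last_rcons cat_rcons eq_sym; apply: faulty_state.
  - by move: inc; rewrite uE increasing_cat => /andP[_ /andP[]].
  rewrite uE in inc faultless; exists (pending p.1 u1).
  split; [exact: pending_pop faultless | exact: pending_gt |].
  rewrite /unzip1 !map_rcons !last_rcons -cats1 pending_cat.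
  by congr (_, _ ++ _); rewrite /pending /= ltrDl ltr01 /= cats0.
exact: (run_from u [::]).
Qed.

End Faults.

Lemma timed_run_reaches c u d : timed_run c u d ->
  reaches D (c.1.1, map snd c.2) (d.1.1, map snd d.2).
Proof.
elim: u c => [|p u IH] c /=; first by move<-; apply: rt_refl.
move=> [c' [pD <- _ [q [-> _ c'E]]] /IH run]; apply: rt_trans run; rewrite c'E.
have snd_stamp t o : map snd (stamp t o) = seq_of_opt o by case: o.
rewrite !map_cat !snd_stamp; apply: rt_step.
by apply: queue_step_rule; apply: mem_nth.
Qed.

Definition ordered q := pairwise (fun x y : R * S => x.1 < y.1) q.

Definition fresh T q := ordered q /\ forall x, x \in q -> x.1 <= T < x.1 + 1.

(* The next date is forced if a symbol is popped; otherwise any date before the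
   expiry of the front symbol will do. *)
Lemma fresh_next_date o w T q : map snd q = seq_of_opt o ++ w -> fresh T q ->
  exists t q', [/\ q = stamp (t - 1) o ++ q', T < t,
    all (fun x => t < x.1 + 1) q', map snd q' = w & ordered q'].
Proof.
move=> qE [q_ord q_fresh]; case: o qE => [b|] /= qE.
  case: q qE q_ord q_fresh => [//|x q] /= [<- qE] /andP[q_gt q_ord] q_fresh.
  have := q_fresh _ (mem_head _ _) => x_fresh.
  exists (x.1 + 1), q; split=> //; first by rewrite addrK -surjective_pairing.
    by lra.
  by apply: sub_all q_gt => y; lra.
case: q qE q_ord q_fresh => [|x q] /= qE q_ord q_fresh.
  by exists (T + 1), [::]; split=> //; lra.
have x_fresh := q_fresh _ (mem_head _ _).
exists ((T + (x.1 + 1)) / 2), (x :: q); split=> //; first by lra.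
apply/andP; split; first by lra.
by case/andP: q_ord => x_lt _; apply: sub_all x_lt => y; lra.
Qed.

Lemma fresh_step r w T q : r \in D -> map snd q = seq_of_opt (pop r) ++ w ->
  fresh T q -> exists t q',
    [/\ timed_step (src r, T, q) (t, index r D) (tgt r, t, q'),
        map snd q' = w ++ seq_of_opt (push r) & fresh t q'].
Proof.
move=> rD qE q_fresh.
have [t [q' [qE' T_lt t_lt q'E q'_ord]]] := fresh_next_date qE q_fresh.
exists t, (q' ++ stamp t (push r)); split.
- have rlE : rl (index r D) = r by rewrite /rl nth_index.
  by split; rewrite /= ?rlE ?index_mem //; exists q'.
- by rewrite map_cat q'E; case: (push r).
have q'_lt x : x \in q' -> x.1 < t.
  move=> xq'; case: q_fresh => _ /(_ x); rewrite qE' mem_cat xq' orbT.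
  by move=> /(_ isT); lra.
split; last first.
  move=> x; rewrite mem_cat mem_stamp => /orP[xq'|/andP[_ /eqP->]]; last by lra.
  by have := allP t_lt _ xq'; have := q'_lt _ xq'; lra.
rewrite /ordered pairwise_cat; apply/and3P; split=> //; last by case: (push r).
by apply/allrelP => x y /q'_lt x_lt; rewrite mem_stamp => /andP[_ /eqP->].
Qed.

Lemma reaches_timed_run (c d : Q * seq S) T q :
  reaches D c d -> map snd q = c.2 -> fresh T q ->
  exists u T' q', [/\ timed_run (c.1, T, q) u (d.1, T', q'),
    map snd q' = d.2 & fresh T' q'].
Proof.
move=> cd; have {}cd := clos_rt_rt1n _ _ _ _ cd.
elim: cd T q => {c d} [c|c d e [r rD [srcE tgtE [w cE dE]]] _ IH] T q.
  by move=> qE q_fresh; exists [::], T, q.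
rewrite cE => qE q_fresh.
have [t [q' [step q'E q'_fresh]]] := fresh_step rD qE q_fresh.
rewrite -dE in q'E.
have [u [T' [q2 [run q2E q2_fresh]]]] := IH _ _ q'E q'_fresh.
exists ((t, index r D) :: u), T', q2; split=> //=.
by exists (tgt r, t, q'); rewrite -?srcE // tgtE.
Qed.

End TimedRuns.

(** * The load phase *)

Lemma represents_input K u :
  0 < K -> represents K (nseq u (Token 0) ++ [:: Marker]) (input_store u).
Proof.
move=> K0; split=> [|r|]; first by rewrite count_cat count_nseq mul0n.
  rewrite count_cat count_nseq addn0 /input_store /upd.
  by case: r => [|r]; rewrite ?mul1n ?mul0n.
by rewrite all_cat all_nseq /= Token_symbols K0 orbT.
Qed.

Lemma represents_rotate K x w s :
  represents K (x :: w) s -> represents K (rcons w x) s.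
Proof. by apply: represents_perm; rewrite perm_sym perm_rcons. Qed.

Lemma represents_push_token K w u : 0 < K ->
  represents K w (input_store u) ->
  represents K (rcons w (Token 0)) (input_store u.+1).
Proof.
move=> K0 [cM cT wK]; rewrite -cats1; split.
- by rewrite count_cat cM.
- move=> r; rewrite count_cat cT /= addn0 /input_store /upd.
  by case: r => [|r]; rewrite ?addn1 ?addn0.
- by rewrite all_cat wK /= andbT Token_symbols.
Qed.

Section LoadPhase.
Local Open Scope ring_scope.
Variables (R : realType) (p : seq instr).
Let D := machine p.
Let K := reg_bound p.
Local Notation rl := (letter_rule load_end D).
Local Notation config := (@timed_config R control symbol).
Implicit Types (t : R) (c e : config).

Lemma letter_load_end a : (a < size D)%N -> rl a = load_end -> a = 0%N.
Proof.
case: a => // a aD aE; have : load_end \in behead D.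
  by rewrite -aE; apply: (@mem_nth _ load_end (behead D) a aD).
rewrite -[behead D]/(behead load_rules ++ prog_rules p) mem_cat => /orP[//|].
by case/flatten_mapP=> pc _ /instr_rule_At[[]].
Qed.

Lemma letter_load a : (a < size D)%N ->
  src (rl a) \in [:: LoadStart; LoadTour; LoadTurn] -> rl a \in load_rules.
Proof.
move=> /(mem_nth load_end); rewrite mem_cat -/(rl a) => /orP[//|].
by case/flatten_mapP => pc _ /instr_rule_At[[met ->]].
Qed.

Definition loading t1 m c := [/\ c.1.1 \in [:: LoadTour; LoadTurn],
  (t1 + m%:R, Marker) \in c.2 &
  represents K (map snd c.2) (input_store (m + (c.1.1 == LoadTour)))].

Lemma loading_marker t1 m c t q : loading t1 m c ->
  c.2 = (t - 1, Marker) :: q -> t = t1 + m.+1%:R.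
Proof.
case=> _ + [cM _ _] cE; move: cM; rewrite cE /= => -[/count_memPn noM].
rewrite inE => /predU1P[[tE]|Mq]; first by rewrite -natr1 addrA tE subrK.
by case/negP: noM; apply/mapP; exists (t1 + m%:R, Marker).
Qed.

Lemma load_step t1 m c a t e :
  loading t1 m c -> timed_step load_end D c (t, a) e ->
  [/\ a = 0%N, e.1.1 = At 0 false, t = t1 + m.+1%:R &
      represents K (map snd e.2) (input_store m.+1)] \/
  a != 0%N /\ exists m', loading t1 m' e.
Proof.
move=> c_load [/= aD srcE _ [q [cE _ ->]]] /=.
have [c_state c_marker c_rep] := c_load.
have /(letter_load aD) : src (rl a) \in [:: LoadStart; LoadTour; LoadTurn].
  by rewrite srcE inE c_state orbT.
have a_neq0 r : rl a = r -> r != load_end -> a != 0%N.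
  by move=> <-; apply: contraNneq => ->.
rewrite !inE => /orP[/eqP rlE|/or4P[]/eqP rlE]; rewrite !rlE /= in srcE cE *.
- left; split=> //; [exact: letter_load_end | exact: loading_marker c_load cE|].
  move: c_rep; rewrite cE -srcE addn1 map_cat cats1.
  exact: represents_rotate.
- by rewrite -srcE in c_state.
- right; split; first exact: a_neq0 rlE _; exists m; split; rewrite //=.
    by rewrite mem_cat; move: c_marker; rewrite cE inE => /predU1P[//|->].
  by move: c_rep; rewrite cE -srcE map_cat cats1; apply: represents_rotate.
- right; split; first exact: a_neq0 rlE _; exists m.+1; split; rewrite //=.
    by rewrite mem_cat inE (loading_marker c_load cE) eqxx orbT.
  move: c_rep; rewrite cE -srcE addn1 addn0 map_cat cats1.
  exact: represents_rotate.
- right; split; first exact: a_neq0 rlE _; exists m; split; rewrite //=.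
    by rewrite mem_cat -cE c_marker.
  move: c_rep; rewrite cE -srcE addn0 addn1 map_cat cats1.
  exact: represents_push_token.
Qed.

Lemma timed_run_running c u e : running c.1.1 -> timed_run load_end D c u e ->
  running e.1.1 /\ 0%N \notin unzip2 u.
Proof.
elim: u c => [|[t a] u IH] c c_run /=; first by move<-.
move=> [c' [aD srcE _ [q [_ _ c'E]]] run]; have rD := mem_nth load_end aD.
case cE: c.1.1 c_run srcE => [|||pc met] // _ srcE.
have [_ _ r_running] := machine_ruleP rD srcE.
have [|e_run nu] := IH _ _ run; first by rewrite c'E.
split=> //; rewrite inE negb_or nu andbT; apply/eqP => a0.
by rewrite -a0 in srcE.
Qed.

Lemma loading_run t1 m c u e : loading t1 m c -> timed_run load_end D c u e ->
  (0%N \notin unzip2 u /\ exists m', loading t1 m' e) \/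
  exists v t u' d k, [/\ u = v ++ (t, 0%N) :: u', t = t1 + k%:R,
    d.1.1 = At 0 false, represents K (map snd d.2) (input_store k) &
    timed_run load_end D d u' e].
Proof.
elim: u m c => [|[t a] u IH] m c c_load /=.
  by move<-; left; split=> //; exists m.
move=> [c' step run].
have [[-> c'E tE rep]|[a0 [m' c'_load]]] := load_step c_load step.
  by right; exists [::], t, u, c', m.+1.
have [[nu e_load]|] := IH _ _ c'_load run.
  by left; rewrite inE negb_or eq_sym a0 nu.
move=> [v [t' [u' [d [k [-> tE dE rep run']]]]]].
by right; exists ((t, a) :: v), t', u', d, k.
Qed.

Lemma loading_init T u e : timed_run load_end D (LoadStart, T, [::]) u e ->
  e.1.1 != LoadStart -> exists t1 a u' c,
    [/\ u = (t1, a) :: u', loading t1 0 c & timed_run load_end D c u' e].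
Proof.
case: u => [|[t a] u] /=; first by move<-; rewrite eqxx.
move=> [c [/= aD srcE _ [q [qE _ cE]]] run] _; exists t, a, u, c.
have := letter_load aD; rewrite srcE !inE => /(_ erefl).
move=> /orP[/eqP rlE|/or4P[]/eqP rlE]; rewrite rlE // /= in srcE qE cE.
split=> //.
rewrite cE -qE; split; rewrite ?inE ?addr0 //=.
exact: (@represents_input K 0 isT).
Qed.

Local Notation codes_halting_run u :=
  (codes_run load_end D LoadStart (halt_state p) 0 u).

Lemma load_timed_run u : (0 < u)%N -> exists (t1 : R) a v t q,
  [/\ 0%N \notin unzip2 v, t = t1 + u%:R, fresh t q,
      map snd q = nseq u (Token 0) ++ [:: Marker] &
      timed_run load_end D (LoadStart, 0, [::]) ((t1, a) :: rcons v (t, 0%N))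
        (At 0 false, t, q)].
Proof.
move=> u0; have nil_fresh : fresh (0 : R) ([::] : seq (R * symbol)) by [].
have [v1 [T1 [q1 [run1 q1E q1_fresh]]]] :=
  @reaches_timed_run R _ _ load_end D _ _ 0 [::]
    (load_reaches p u0) erefl nil_fresh.
have [t [q [step qE q_fresh]]] := @fresh_step R _ _ load_end D load_end
  (nseq u (Token 0)) T1 q1 (mem_head _ _) q1E q1_fresh.
have [t1 [a [v [c [v1E c_load run]]]]] := loading_init run1 isT.
case: (loading_run c_load run) => [[nv [m e_load]]|]; last first.
  move=> [? [? [? [d [? [_ _ dE _ /timed_run_running[]]]]]]] //.
  by rewrite dE.
exists t1, a, v, t, q; split=> //; last first.
  rewrite -cats1 -cat_cons -v1E; apply/timed_run_cat.
  by exists (LoadTour, T1, q1) => //; eexists; first exact: step.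
case: (load_step e_load step) => [[_ _ -> [_ /(_ 0%N) + _]]|[] //].
by rewrite /= qE count_cat count_nseq mul1n addn0 => ->.
Qed.

Lemma codes_halting_run_of_reaches u w : (0 < u)%N ->
  reaches D (At 0 false, nseq u (Token 0) ++ [:: Marker]) (halt_state p, w) ->
  exists v : seq (event R),
    [/\ increasing 0 v, is_word D v & codes_halting_run u v].
Proof.
move=> /load_timed_run[t1 [a [v1 [t [q [nv1 tE q_fresh qE run1]]]]]] halts.
have [v2 [T' [q' [run2 _ _]]]] := reaches_timed_run load_end halts qE q_fresh.
have [//|_ nv2] := timed_run_running _ run2.
have run : timed_run load_end D (LoadStart, 0, [::])
    ((t1, a) :: v1 ++ (t, 0%N) :: v2) (halt_state p, T', q').
  rewrite -cat_rcons -cat_cons; apply/timed_run_cat.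
  by exists (At 0 false, t, q).
exists ((t1, a) :: v1 ++ (t, 0%N) :: v2); split.
- exact: timed_run_increasing run.
- exact: timed_run_is_word run.
split=> //; last by exists T', q'.
move=> t2 a2 v t' u2 [<- _ vE].
have : (t', 0%N) \in v1 ++ (t, 0%N) :: v2 by rewrite vE mem_cat mem_head orbT.
rewrite mem_cat inE => /or3P[/(map_f snd)|/eqP[->] //|/(map_f snd)].
  by rewrite (negbTE nv1).
by rewrite (negbTE nv2).
Qed.

Lemma reaches_of_codes_halting_run u (v : seq (event R)) :
  codes_halting_run u v ->
  exists w w', represents K w (input_store u) /\
    reaches D (At 0 false, w) (halt_state p, w').
Proof.
move=> [_ v_on_time [T [q run]]].
have [t1 [a [v' [c [vE c_load run']]]]] := loading_init run isT.
case: (loading_run c_load run') => [[_ [m []]] //|].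
move=> [v1 [t [v2 [d [k [v'E tE dE rep run2]]]]]].
have uE : u = k.
  move: (v_on_time t1 a v1 t v2); rewrite vE v'E tE => /(_ erefl)/addrI/eqP.
  by rewrite eqr_nat => /eqP.
exists (map snd d.2), (map snd q); split; first by rewrite uE.
by have := timed_run_reaches run2; rewrite dE.
Qed.

End LoadPhase.

(** * Automata reading dates *)

Section Dates.
Local Open Scope ring_scope.
Variable R : realType.

Fixpoint dates k (T : R) (w : timed_word R k) : seq (event R) :=
  if w is (t, a) :: w' then (T + t%:num, val a) :: dates (T + t%:num) w'
  else [::].

Lemma increasing_dates k T (w : timed_word R k) : increasing T (dates T w).
Proof.
elim: w T => //= [[t a] w IH] T; rewrite /increasing /= ltrDl [0 < _]gt0.
exact: IH.
Qed.

Lemma dates_bounded k T (w : timed_word R k) :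
  all (fun p => p.2 < k)%N (dates T w).
Proof.
elim: w T => //= [[t a] w IH] T /=; rewrite IH andbT.
exact: ltn_ord.
Qed.

Lemma dates_onto k T (u : seq (event R)) : increasing T u ->
  all (fun p => p.2 < k)%N u -> exists w : timed_word R k, dates T w = u.
Proof.
elim: u T => [|[t a] u IH] T; first by exists [::].
rewrite /increasing /= => /andP[Tt inc] /andP[ak uk].
have [w wE] := IH t inc uk; have t0 : 0 < t - T by rewrite subr_gt0.
exists ((PosNum t0, Ordinal ak) :: w) => /=.
by rewrite addrC subrK wE.
Qed.

Variables (k n : nat) (A : timed_automaton k n).
Implicit Types (rho : 'I_n -> R) (w : seq (event R)).

(* The clock valuation is given by the dates [rho] of the last resets. *)
Fixpoint accepts_dates (s : 'I_(nb_states A)) rho w : Prop :=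
  match w with
  | [::] => s \in final A
  | (T, a) :: w' =>
      exists2 e, e \in transitions A &
        [/\ tr_source e = s, val (tr_letter e) = a,
            sat (fun x => T - rho x) (tr_guard e) &
            accepts_dates (tr_target e)
              (fun x => if x \in tr_resets e then T else rho x) w']
  end.

Lemma accepts_from_dates s nu T (w : timed_word R k) :
  accepts_from s nu w <-> accepts_dates s (fun x => T - nu x) (dates T w).
Proof.
elim: w s nu T => [|[t a] w IH] s nu T //=.
have elapseE : elapse nu t%:num = (fun x => T + t%:num - (T - nu x)).
  by apply: funext => x; rewrite /elapse; lra.
have resetE r : (fun x => T + t%:num - reset (elapse nu t%:num) r x) =
    (fun x => if x \in r then T + t%:num else T - nu x).
  by apply: funext => x; rewrite /reset /elapse; case: ifP => _; lra.
split=> -[e eA [se ae guard_e run]]; exists e => //; split=> //.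
- by rewrite ae.
- by rewrite -elapseE.
- by rewrite -resetE; apply/IH.
- exact: val_inj.
- by rewrite elapseE.
- by apply/(IH _ _ (T + t%:num)); rewrite resetE.
Qed.

Definition accepted w :=
  exists2 s, s \in initial A & accepts_dates s (fun=> 0) w.

Lemma languageP (w : timed_word R k) : language R A w <-> accepted (dates 0 w).
Proof.
have rho0 : (fun=> 0 - 0) = (fun=> 0) :> ('I_n -> R).
  by apply: funext => x; rewrite subr0.
split=> -[s si run]; exists s => //; last first.
  by apply/(accepts_from_dates _ _ 0); rewrite rho0.
by move/(accepts_from_dates _ _ 0): run; rewrite rho0.
Qed.

End Dates.

Lemma language_eqP (R : realType) k n m (A : timed_automaton k n)
    (B : timed_automaton k m) : language R B = language R A <->
  forall w : seq (event R), increasing 0 w -> all (fun p => p.2 < k)%N w ->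
    accepted B w <-> accepted A w.
Proof.
split=> [BA w inc wk|BA].
  by have [w' <-] := dates_onto inc wk; rewrite -!languageP BA.
have BA_dates (w : timed_word R k) :=
  BA _ (increasing_dates 0 w) (dates_bounded 0 w).
by apply/seteqP; split=> w /languageP/BA_dates/languageP.
Qed.

(** * A language requiring n clocks *)

Section Perturbation.
Local Open Scope ring_scope.
Variable R : realType.

Definition same_cell (x y : R) :=
  exists i : nat, i%:R < x < i%:R + 1 /\ i%:R < y < i%:R + 1.

Lemma cell_lt_nat (i c : nat) (x : R) : i%:R < x < i%:R + 1 ->
  (x < c%:R) = (i < c)%N /\ (c%:R < x) = (c <= i)%N.
Proof.
rewrite natr1 => /andP[ix xi]; case: leqP => [ci|ic].
  have cx : c%:R < x by apply: le_lt_trans ix; rewrite ler_nat.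
  by rewrite cx ltNge (ltW cx).
have xc : x < c%:R by apply: lt_le_trans xi _; rewrite ler_nat.
by rewrite xc ltNge (ltW xc).
Qed.

Lemma compare_same_cell o x y c : same_cell x y ->
  compare o x c%:R = compare o y c%:R.
Proof.
case=> i [/(cell_lt_nat c)[x_lt lt_x] /(cell_lt_nat c)[y_lt lt_y]].
by case: o; rewrite /= ?eq_le ?leNgt ?x_lt ?lt_x ?y_lt ?lt_y.
Qed.

Lemma sat_same_cell n (nu nu' : valuation R n) g :
  (forall x, nu x = nu' x \/ same_cell (nu x) (nu' x)) -> sat nu g = sat nu' g.
Proof.
move=> cell; elim: g => //= [x o c|g -> //|g -> g' -> //|g -> g' -> //].
by case: (cell x) => [->//|]; apply: compare_same_cell.
Qed.

Variables (k n : nat) (B : timed_automaton k n).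
Implicit Types (rho : 'I_n -> R) (w : seq (event R)) (s : 'I_(nb_states B)).

Lemma accepts_dates_cat s rho w1 w2 : accepts_dates s rho (w1 ++ w2) ->
  exists s' rho', [/\ forall x, rho' x = rho x \/ rho' x \in unzip1 w1,
    accepts_dates s' rho' w2 &
    forall w, accepts_dates s' rho' w -> accepts_dates s rho (w1 ++ w)].
Proof.
elim: w1 s rho => [|[t a] w1 IH] s rho /=.
  by move=> run; exists s, rho; split=> // x; left.
move=> [e eB [se ae guard_e /IH[s' [rho' [rho'E run run_w]]]]].
exists s', rho'; split=> // [x|w /run_w]; last by exists e.
case: (rho'E x) => [->|xw]; last by right; rewrite inE xw orbT.
by case: ifP => _; [right; rewrite mem_head | left].
Qed.

Lemma accepts_same_cell s rho rho' w : accepts_dates s rho w ->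
  (forall x, rho x = rho' x \/
     forall p, p \in w -> same_cell (p.1 - rho x) (p.1 - rho' x)) ->
  accepts_dates s rho' w.
Proof.
elim: w s rho rho' => [//|[t a] w IH] s rho rho' /=.
move=> [e eB [se ae guard_e run]] cell; exists e => //; split=> //.
  rewrite -(sat_same_cell (nu := fun x => t - rho x)) // => x.
  by case: (cell x) => [->|/(_ _ (mem_head _ _))]; [left | right].
apply: IH run _ => x; case: ifP => _; first by left.
case: (cell x) => [->|cell_x]; [by left|right=> p pw].
by apply: cell_x; rewrite inE pw orbT.
Qed.

Lemma accepts_move_date s rho w1 t t' a w2 :
  accepts_dates s rho (w1 ++ (t, a) :: w2) ->
  (forall x, same_cell (t - rho x) (t' - rho x)) ->
  (forall p, p \in w1 -> same_cell (t - p.1) (t' - p.1)) ->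
  (forall p, p \in w2 -> same_cell (p.1 - t) (p.1 - t')) ->
  accepts_dates s rho (w1 ++ (t', a) :: w2).
Proof.
move=> /accepts_dates_cat[s' [rho' [rho'E [e eB [se ae guard_e run]] run_w1]]].
move=> cell_rho cell_w1 cell_w2; apply: run_w1; exists e => //; split=> //.
  rewrite -(sat_same_cell (nu := fun x => t - rho' x)) // => x; right.
  case: (rho'E x) => [->|/mapP[p pw1 ->]]; first exact: cell_rho.
  exact: cell_w1.
apply: accepts_same_cell run _ => x; case: ifP => _; last by left.
by right.
Qed.

Lemma common_cell (S : R) (Z : seq R) : {in Z, forall z, z <= S} ->
  exists2 eta, 0 < eta < 1 & forall z, z \in Z ->
    exists i : nat, i%:R <= S - z /\ S + eta - z < i%:R + 1.
Proof.
elim: Z => [|z Z IH] leS; first by exists (1 / 2) => //; lra.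
have [|eta eta01 cellZ] := IH.
  by move=> y yZ; apply: leS; rewrite inE yZ orbT.
have z0 : 0 <= S - z by rewrite subr_ge0 leS ?mem_head.
have /andP[i1 i2] := truncn_itv z0; move: i2; rewrite -natr1 => i2.
pose eta' := ((Num.truncn (S - z))%:R + 1 - (S - z)) / 2.
have eta'0 : 0 < eta' by rewrite /eta'; move: i1 i2; set i := _%:R; lra.
have eta'_lt : S + eta' - z < (Num.truncn (S - z))%:R + 1.
  by rewrite /eta'; move: i1 i2; set i := _%:R; lra.
exists (Num.min eta eta'); first by rewrite lt_min gt_min; lra.
move=> y; rewrite inE => /predU1P[->|/cellZ[i [leS_i lt_i]]].
  exists (Num.truncn (S - z)); split=> //; apply: le_lt_trans eta'_lt.
  by rewrite lerD2r lerD2l ge_min lexx orbT.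
exists i; split=> //; apply: le_lt_trans lt_i.
by rewrite lerD2r lerD2l ge_min lexx.
Qed.

End Perturbation.

Lemma forgotten_value (T : eqType) p n (rho : 'I_p -> T) (tau : nat -> T) :
  p < n -> injective tau -> exists2 i, i < n & forall x, rho x <> tau i.
Proof.
move=> pn tau_inj; apply: contrapT => all_kept.
have : size [seq tau l | l <- iota 0 n] <= size (codom rho).
  apply: uniq_leq_size; first by rewrite map_inj_uniq ?iota_uniq.
  move=> y /mapP[l]; rewrite mem_iota => /= ln ->.
  apply: contrapT => nl; apply: all_kept; exists l => // x rhoE; apply: nl.
  by rewrite -rhoE codom_f.
by rewrite size_map size_iota size_codom card_ord leqNgt pn.
Qed.

Section UnitDelays.
Local Open Scope ring_scope.
Variable R : realType.

Definition unit_delays n (cs : seq (event R)) := size cs = n.*2 /\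
  forall i, (i < n)%N -> nth 0 (unzip1 cs) (n + i) - nth 0 (unzip1 cs) i = 1.

Section Blocks.
Variables (n d : nat) (S eta : R).
Hypothesis eta01 : 0 < eta < 1.

Definition gap := eta / n.+1%:R.

Definition tau i := S + gap * i.+1%:R.

Definition block (f : nat -> R) := [seq (f l, d) | l <- iota 0 n].

Definition late_tau i t l := if l == i then t else tau l + 1.

Lemma gap_gt0 : 0 < gap.
Proof. by case/andP: eta01 => eta0 _; rewrite divr_gt0 ?ltr0n. Qed.

Lemma tau_gt l : S + gap <= tau l.
Proof.
by rewrite lerD2l -[leLHS]mulr1 ler_pM2l ?gap_gt0 // (ler_nat _ 1).
Qed.

Lemma tau_gap l l' : (l < l')%N -> tau l + gap <= tau l'.
Proof.
move=> ll'; rewrite /tau -addrA lerD2l -[X in _ + X <= _]mulr1 -mulrDr natr1.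
by rewrite ler_pM2l ?gap_gt0 // ler_nat.
Qed.

Lemma tau_le l : (l < n)%N -> tau l + gap <= S + eta.
Proof.
move=> ln; rewrite /tau -addrA lerD2l -[X in _ + X <= _]mulr1 -mulrDr natr1.
rewrite /gap mulrAC ler_pdivrMr ?ltr0n // ler_pM2l ?ler_nat //.
by case/andP: eta01.
Qed.

Lemma tau_inj : injective tau.
Proof.
move=> l l' tauE; case: (ltngtP l l') => // /tau_gap;
by rewrite tauE gerDl leNgt gap_gt0.
Qed.

Lemma late_tau_bounds i t l : tau i + 1 <= t < tau i + 1 + gap ->
  tau l + 1 <= late_tau i t l < tau l + 1 + gap.
Proof.
rewrite /late_tau; case: eqP => [->|_ _] //.
by have := gap_gt0; lra.
Qed.

Lemma late_tau_id i : late_tau i (tau i + 1) =1 (fun l => tau l + 1).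
Proof. by move=> l; rewrite /late_tau; case: eqP => [->|]. Qed.

Lemma block_late_split i t : (i < n)%N -> block (late_tau i t) =
  [seq (tau l + 1, d) | l <- iota 0 i] ++
  (t, d) :: [seq (tau l + 1, d) | l <- iota i.+1 (n - i.+1)].
Proof.
move=> i_n; rewrite /block.
have -> : iota 0 n = iota 0 i ++ i :: iota i.+1 (n - i.+1).
  have {1}-> : n = (i + (n - i.+1).+1)%N by lia.
  by rewrite iotaD.
rewrite map_cat /= {2}/late_tau eqxx; congr (_ ++ _ :: _); apply/eq_in_map => l;
  by rewrite mem_iota /late_tau => ?; rewrite ifF //; lia.
Qed.

Lemma increasing_block T f : (forall l, T < f l) ->
  {homo f : l l' / (l < l')%N >-> l < l'} -> increasing T (block f).
Proof.
move=> T_lt f_lt.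
have -> : increasing T (block f) = path <%R T (map f (iota 0 n)).
  by rewrite /increasing /unzip1 -map_comp.
rewrite path_min_sorted; last first.
  by rewrite all_map; apply/allP => l _ /=.
exact: (homo_sorted f_lt) (iota_ltn_sorted 0 n).
Qed.

Lemma block_delay i t j : (j < n)%N ->
  nth 0 (unzip1 (block tau ++ block (late_tau i t))) (n + j) -
    nth 0 (unzip1 (block tau ++ block (late_tau i t))) j =
  late_tau i t j - tau j.
Proof.
move=> jn; rewrite /unzip1 map_cat -!map_comp !nth_cat !size_map size_iota jn.
rewrite ifF ?addKn; last by lia.
by rewrite !(nth_map 0%N) ?size_iota // !nth_iota.
Qed.

Lemma increasing_blocks u i t : increasing 0 u -> S = last 0 (unzip1 u) ->
  (i < n)%N -> tau i + 1 <= t < tau i + 1 + gap ->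
  increasing 0 (u ++ block tau ++ block (late_tau i t)).
Proof.
move=> inc SE i_n t_near; have late_bounds := late_tau_bounds _ t_near.
rewrite increasing_cat inc -SE; apply: increasing_catI.
- apply: increasing_block => [l|l l' /tau_gap]; last by have := gap_gt0; lra.
  by have := tau_gt l; have := gap_gt0; lra.
- apply: increasing_block => [l|l l' /tau_gap].
    by have := tau_gt l; have := late_bounds l; have := gap_gt0; lra.
  by have := late_bounds l; have := late_bounds l'; lra.
- move=> _ _ /mapP[l + ->] /mapP[l' _ ->] /=; rewrite mem_iota => /tau_le.
  have := tau_gt l'; have := late_bounds l'; have := gap_gt0.
  by case/andP: eta01; lra.
Qed.

Lemma unit_delays_blocks i t : (i < n)%N ->
  unit_delays n (block tau ++ block (late_tau i t)) -> t = tau i + 1.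
Proof.
move=> i_n [_ /(_ i i_n)]; rewrite block_delay // /late_tau eqxx.
by move/eqP; rewrite subr_eq addrC => /eqP.
Qed.

Lemma blocks_unit_delays i :
  unit_delays n (block tau ++ block (late_tau i (tau i + 1))).
Proof.
split=> [|j jn]; first by rewrite size_cat !size_map size_iota addnn.
by rewrite block_delay // late_tau_id addrAC subrr add0r.
Qed.

Section LateCells.
Variables (i : nat) (t : R).
Hypotheses (i_n : (i < n)%N) (t_near : tau i + 1 <= t < tau i + 1 + gap).

Lemma same_cell_since z :
  (exists j : nat, j%:R <= S - z /\ S + eta - z < j%:R + 1) ->
  same_cell (tau i + 1 - z) (t - z).
Proof.
case=> j [leS lt]; exists j.+1; rewrite -natr1.
by have := tau_gt i; have := tau_le i_n; have := gap_gt0; move: t_near; lra.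
Qed.

Lemma same_cell_since_tau l : (l < n)%N -> l != i ->
  same_cell (tau i + 1 - tau l) (t - tau l).
Proof.
move=> l_n; have [li|il|//] := ltngtP l i => _; [exists 1%N | exists 0%N];
  have := tau_gt l; have := tau_gt i; have := tau_le l_n; have := tau_le i_n;
  have := gap_gt0; case/andP: eta01; move: t_near.
  by have := tau_gap li; lra.
by have := tau_gap il; lra.
Qed.

Lemma same_cell_since_late l : (l < i)%N ->
  same_cell (tau i + 1 - (tau l + 1)) (t - (tau l + 1)).
Proof.
move=> li; exists 0%N; have := tau_gap li; have := tau_gt l; have := tau_le i_n.
by have := gap_gt0; case/andP: eta01; move: t_near; lra.
Qed.

Lemma same_cell_until_late l : (i < l < n)%N ->
  same_cell (tau l + 1 - (tau i + 1)) (tau l + 1 - t).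
Proof.
case/andP=> il l_n; exists 0%N; have := tau_gap il; have := tau_gt i.
by have := tau_le l_n; have := gap_gt0; case/andP: eta01; move: t_near; lra.
Qed.

End LateCells.

End Blocks.

(* The [n] dates [tau i] cannot all be remembered by fewer than [n] clocks, and
   the date [tau i + 1] may be moved slightly if no clock remembers [tau i]. *)
Lemma unit_delays_need_clocks k p n d (B : timed_automaton k p)
    (u : seq (event R)) : (p < n)%N -> increasing 0 u ->
  ~ forall cs : seq (event R), increasing 0 (u ++ cs) ->
    all (fun p => p.2 == d) cs -> accepted B (u ++ cs) <-> unit_delays n cs.
Proof.
move=> pn inc accP; have n0 : (0 < n)%N by apply: leq_ltn_trans pn.
set S := last 0 (unzip1 u).
have [|eta eta01 cell] := @common_cell R S (0 :: unzip1 u).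
  move=> z; rewrite inE => /predU1P[->|/mapP[p' p'u ->]]; first exact: last_ge0.
  exact: increasing_last.
pose t i := tau n S eta i; pose word := block n d t.
pose late i t' := block n d (late_tau n S eta i t').
have letters i t' : all (fun p => p.2 == d) (word ++ late i t').
  by rewrite all_cat !all_map; apply/andP; split; apply/allP => l _ /=.
have [s si] : accepted B (u ++ word ++ late 0%N (t 0%N + 1)).
  apply/accP => //; last exact: blocks_unit_delays.
  by apply: increasing_blocks => //; rewrite lexx ltrDl gap_gt0.
rewrite catA => /accepts_dates_cat[s1 [rho1 [rho1E run1 run_w]]].
have [i i_n forgotten] := forgotten_value rho1 pn (@tau_inj n S eta eta01).
have lateE : late 0%N (t 0%N + 1) = late i (t i + 1).
  by rewrite /late /block; apply: eq_map => l; rewrite !late_tau_id.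
pose t' := t i + 1 + gap n eta / 2.
have t'_near : t i + 1 <= t' < t i + 1 + gap n eta.
  by have := gap_gt0 n eta01; rewrite /t'; lra.
have : accepted B (u ++ word ++ late i t').
  exists s => //; rewrite catA; apply: run_w; rewrite /late block_late_split //.
  rewrite lateE /late block_late_split // in run1.
  apply: (accepts_move_date run1) => [x|p'|p'].
  - case: (rho1E x) => [->|].
      by apply: same_cell_since => //; apply/cell/mem_head.
    rewrite /unzip1 map_cat mem_cat => /orP[xu|/mapP[p' /mapP[l l_n ->] /= xE]].
      by apply: same_cell_since => //; apply: cell; rewrite inE xu orbT.
    rewrite xE; apply: same_cell_since_tau => //.
      by rewrite mem_iota in l_n.
    by apply/eqP => li; apply: (forgotten x); rewrite xE li.
  - by case/mapP=> l; rewrite mem_iota => li ->; apply: same_cell_since_late.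
  - case/mapP=> l; rewrite mem_iota => il ->; apply: same_cell_until_late => //.
    by lia.
rewrite accP // => [/unit_delays_blocks-/(_ eta01 i_n)|].
  by rewrite /t' -/(t i); have := gap_gt0 n eta01; lra.
exact: increasing_blocks.
Qed.

End UnitDelays.

(** * Numbered automata *)

HB.instance Definition _ n :=
  Equality.copy (guard n) (inj_type (@guard_code_inj n)).

Record arrow (n : nat) (st : Type) := Arrow {
  arrow_guard : guard n;
  arrow_resets : {set 'I_n};
  arrow_target : st }.

Definition arrow_tuple n st (x : arrow n st) :=
  (arrow_guard x, arrow_resets x, arrow_target x).

Lemma arrow_tupleK n st :
  cancel (@arrow_tuple n st) (fun x => Arrow x.1.1 x.1.2 x.2).
Proof. by case. Qed.

HB.instance Definition _ n (st : eqType) :=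
  Equality.copy (arrow n st) (can_type (@arrow_tupleK n st)).

Lemma set_code_sorted q (l : seq nat) :
  sorted ltn l -> all (fun i => i <= q) l ->
  set_code [set i : 'I_q.+1 | val i \in l] = CodeSeq.code l.
Proof.
move=> l_sorted l_q; rewrite /set_code; congr CodeSeq.code.
apply: (irr_sorted_eq ltn_trans ltnn _ l_sorted) => [|x].
  rewrite sorted_map; apply: (@subseq_sorted _ _ _ _ (enum 'I_q.+1)).
  - by move=> i j k; apply: ltn_trans.
  - by rewrite {1}/enum_mem -enumT; apply: filter_subseq.
  - by rewrite -sorted_map val_enum_ord iota_ltn_sorted.
apply/mapP/idP => [[i]|xl]; first by rewrite mem_enum inE => il ->.
exists (inord x); rewrite ?mem_enum ?inE /= inordK //; exact: (allP l_q).
Qed.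

Section NumberedAutomata.
Variables (n : nat) (st : eqType) (num : st -> nat).
Hypothesis num_inj : injective num.
Local Notation edge := (st * nat * arrow n st)%type.
Implicit Types (e : edge) (s : st).

Definition edge_code e : nat := CodeSeq.code [:: num e.1.1; e.1.2;
  guard_code (arrow_guard e.2); set_code (arrow_resets e.2);
  num (arrow_target e.2)].

Variables k q : nat.

Definition number_edge e : transition k.+1 q.+1 n :=
  Transition (inord (num e.1.1)) (inord e.1.2) (arrow_guard e.2)
    (arrow_resets e.2) (inord (num (arrow_target e.2))).

Definition numbered_automaton (ini fin : seq st) (es : seq edge) :=
  @TimedAutomaton k.+1 n q.+1 [set i | val i \in map num ini]
    [set i | val i \in map num fin] (map number_edge es).

Definition edge_bounded e :=
  [&& num e.1.1 <= q, e.1.2 <= k & num (arrow_target e.2) <= q].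

Lemma transition_code_number_edge e : edge_bounded e ->
  transition_code (number_edge e) = edge_code e.
Proof. by case/and3P=> *; rewrite /transition_code /edge_code /= !inordK. Qed.

Lemma numbered_automaton_code ini fin es :
  sorted ltn (map num ini) -> all (fun s => num s <= q) ini ->
  sorted ltn (map num fin) -> all (fun s => num s <= q) fin ->
  all edge_bounded es ->
  automaton_code (existT _ _ (numbered_automaton ini fin es)) = CodeSeq.code
    [:: k.+1; q.+1; CodeSeq.code (map num ini); CodeSeq.code (map num fin);
        CodeSeq.code (map edge_code es)].
Proof.
move=> ini_sorted ini_q fin_sorted fin_q es_bounded.
have -> : map edge_code es = map (@transition_code _ _ _) (map number_edge es).
  rewrite -map_comp; apply/eq_in_map => e /(allP es_bounded) e_bounded /=.
  by rewrite transition_code_number_edge.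
rewrite -(set_code_sorted (q := q) ini_sorted) ?all_map //.
by rewrite -(set_code_sorted (q := q) fin_sorted) ?all_map.
Qed.

Local Open Scope ring_scope.
Variables (R : realType) (out : st -> nat -> seq (arrow n st)).
Variables (ini fin : seq st) (es : seq edge) (valid : pred st).
Implicit Types (rho : 'I_n -> R) (w : seq (event R)).

Fixpoint accepts_graph s rho w : Prop :=
  match w with
  | [::] => s \in fin
  | (t, a) :: w' =>
      exists2 x, x \in out s a & sat (fun y => t - rho y) (arrow_guard x) /\
        accepts_graph (arrow_target x)
          (fun y => if y \in arrow_resets x then t else rho y) w'
  end.

Hypothesis es_bounded : all edge_bounded es.
Hypothesis mem_es :
  forall s a x, valid s -> ((s, a, x) \in es) = (x \in out s a).
Hypothesis out_valid :
  forall s a x, valid s -> x \in out s a -> valid (arrow_target x).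
Hypothesis valid_bounded : forall s, valid s -> (num s <= q)%N.

Let A := numbered_automaton ini fin es.

Lemma accepts_dates_numbered s rho w :
  valid s -> all (fun p => p.2 < k.+1)%N w ->
  accepts_dates (A := A) (inord (num s)) rho w <-> accepts_graph s rho w.
Proof.
elim: w s rho => [|[t a] w IH] s rho s_valid /=.
  by rewrite inE /= inordK ?ltnS ?valid_bounded // mem_map.
move=> /andP[ak wk]; split.
  move=> [_ /mapP[[[s' a'] x] e_es ->] [/= s'E a'E guard_x run]].
  have /and3P[/= s'_q a'_k x_q] := allP es_bounded _ e_es.
  have s's : s' = s.
    apply: num_inj; move/(congr1 val): s'E.
    by rewrite /= !inordK // ltnS valid_bounded.
  have a'a : a' = a by rewrite -a'E inordK.
  rewrite {}s's {}a'a mem_es // in e_es; exists x => //; split=> //.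
  by apply/IH => //; apply: out_valid e_es.
move=> [x x_out [guard_x run]]; have e_es : (s, a, x) \in es by rewrite mem_es.
exists (number_edge (s, a, x)); first exact: map_f.
split=> //=; first by rewrite inordK.
by apply/IH => //; apply: out_valid x_out.
Qed.

Lemma accepted_numbered w : all valid ini -> all (fun p => p.2 < k.+1)%N w ->
  accepted A w <-> exists2 s, s \in ini & accepts_graph s (fun=> 0) w.
Proof.
move=> /allP ini_valid wk; split=> -[s s_ini run].
  move: s_ini; rewrite inE => /mapP[s' s'_ini sE]; exists s' => //.
  apply/accepts_dates_numbered => //; first exact: ini_valid.
  by rewrite -sE inord_val.
have s_q := valid_bounded (ini_valid _ s_ini).
exists (inord (num s)); first by rewrite inE /= inordK // map_f.
by apply/accepts_dates_numbered => //; apply: ini_valid.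
Qed.

End NumberedAutomata.

Arguments accepts_graph : simpl never.

(** * The fault-finding automaton *)

Lemma exists_in_foldr (T : eqType) (P : T -> Prop) s :
  (exists2 x, x \in s & P x) <-> foldr (fun x => or (P x)) False s.
Proof.
elim: s => [|y s IH] /=; first by split=> // -[].
rewrite -IH; split=> [[x]|[Py|[x xs Px]]].
- by rewrite inE => /predU1P[->|xs Px]; [left | right; exists x].
- by exists y; rewrite ?mem_head.
- by exists x; rewrite // inE xs orbT.
Qed.

(* The automaton recognizes the words [u ++ cs] where either [u] is [faulty] or
   the dates of [cs] satisfy [unit_delays]. [Guess] reads the part of [u] before
   a fault and [Start] looks for faults relative to the first event; [Found]
   and [Tail] read the rest of the word after a fault. [Succ a] and [Match a]
   watch the successor of an event [a] and the date one unit later. [Gap] comes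
   after an event and [NextGap] after its successor, in search of an event more
   than one unit after the former and less than one unit after the latter.
   [Early] and [Delay] measure the time since the first event. [Chain j] has
   read [j] letters of [cs]. *)
Inductive state :=
  | Guess | Start | Found | Tail | Gap | NextGap | Early | Delay
  | Chain of nat | Match of nat | Succ of nat.

Definition num s := match s with
  | Guess => 0 | Start => 1 | Found => 2 | Tail => 3
  | Gap => 4 | NextGap => 5 | Early => 6 | Delay => 7
  | Chain j => 8 + 3 * j | Match a => 9 + 3 * a | Succ a => 10 + 3 * a end.

Lemma num_inj : injective num.
Proof.
by case=> [||||||||j|j|j] [||||||||i|i|i] //=; rewrite ?plusE ?multE => numE;
  first [exfalso; lia | congr Chain; lia | congr Match; lia | congr Succ; lia].
Qed.

HB.instance Definition _ := Equality.copy state (inj_type num_inj).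

Section FaultFinder.
Variables (Q S : eqType) (r0 : rule Q S) (D : seq (rule Q S)).
Variables (start halt : Q) (mark m : nat).
Let n := m.+2.
Local Notation rl := (letter_rule r0 D).
Local Notation arrow := (arrow n state).

Definition clk0 : 'I_n := inord 0.
Definition clk1 : 'I_n := inord 1.

Lemma clk01 : clk0 != clk1.
Proof. by rewrite -val_eqE /= !inordK. Qed.

Let true_guard := GTrue n.
Let atom x o := @GAtom n x o 1.
Let no_reset : {set 'I_n} := finset.set0.

Definition when b (g : guard n) : guard n := if b then g else GNot true_guard.

Definition chain_out j : seq arrow :=
  if j < n then [:: Arrow true_guard [set inord j] (Chain j.+1)]
  else if j < n.*2 then
    [:: Arrow (atom (inord (j - n)) OpEq) no_reset (Chain j.+1)]
  else [::].

Definition letter_out s a : seq arrow :=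
  let r := rl a in let pops := pop r != None in
  match s with
  | Guess =>
      [:: Arrow true_guard no_reset Guess; Arrow true_guard no_reset (Succ a);
          Arrow true_guard [set clk0] (Match a);
          Arrow true_guard [set clk0] Gap;
          Arrow (when (tgt r != halt) true_guard) no_reset Tail]
  | Start =>
      [:: Arrow (when (src r != start) true_guard) no_reset Found;
          Arrow (when pops true_guard) no_reset Found;
          Arrow true_guard [set clk1] Early; Arrow true_guard [set clk0] Delay]
  | Found => [:: Arrow true_guard no_reset Found]
  | Gap =>
      [:: Arrow true_guard [set clk1] NextGap;
          Arrow (when pops (atom clk0 OpGt)) no_reset Found]
  | NextGap =>
      [:: Arrow true_guard no_reset NextGap;
          Arrow (when pops (GAnd (atom clk0 OpGt) (atom clk1 OpLt)))
            no_reset Found]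
  | Early =>
      [:: Arrow true_guard no_reset Early;
          Arrow (when pops (atom clk1 OpLt)) no_reset Found]
  | Delay => [:: Arrow true_guard no_reset Delay]
  | Match b =>
      [:: Arrow (atom clk0 OpLt) no_reset (Match b);
          Arrow (when (pop r != push (rl b)) (atom clk0 OpEq)) no_reset Found;
          Arrow (when (push (rl b) != None) (atom clk0 OpGt)) no_reset Found]
  | Succ b => [:: Arrow (when (tgt (rl b) != src r) true_guard) no_reset Found]
  | Tail | Chain _ => [::]
  end.

Definition tail_out s : seq arrow :=
  match s with
  | Guess => chain_out 0
  | Chain j => chain_out j
  | Start | Found | Tail => [:: Arrow true_guard no_reset Tail]
  | _ => [::]
  end.

Definition late_mark c : arrow :=
  Arrow (GNot (GAtom clk0 OpEq c)) no_reset Found.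

(* All arrows but the one that contains the constant [c]. *)
Definition base_out s a :=
  if a < size D then letter_out s a
  else if a == size D then tail_out s else [::].

Definition out c s a : seq arrow :=
  if (s == Delay) && (a == mark) then late_mark c :: base_out s a
  else base_out s a.

Definition initials := [:: Guess; Start].

Definition finals := [:: Start; Found; Tail; Chain n.*2].

Local Open Scope ring_scope.
Variables (R : realType) (c : nat).
Hypothesis mark_lt : (mark < size D)%N.
Implicit Types (rho : 'I_n -> R) (u w cs : seq (event R)).

Local Notation accepts := (accepts_graph (R := R) (out c) finals).
Local Notation is_word := (is_word D).

Definition is_tail cs := all (fun p => p.2 == size D) cs.

Definition set_clock rho (x : 'I_n) t : 'I_n -> R :=
  fun y => if y == x then t else rho y.

Lemma reset_set0 (t : R) rho :
  (fun y => if y \in no_reset then t else rho y) = rho.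
Proof. by apply: funext => y; rewrite finset.in_set0. Qed.

Lemma reset_set1 (t : R) rho x :
  (fun y => if y \in [set x]%SET then t else rho y) = set_clock rho x t.
Proof. by apply: funext => y; rewrite finset.in_set1. Qed.

Lemma sat_when b g (nu : valuation R n) : sat nu (when b g) = b && sat nu g.
Proof. by case: b. Qed.

Lemma out_letter s a : (a < size D)%N -> out c s a =
  if (s == Delay) && (a == mark) then late_mark c :: letter_out s a
  else letter_out s a.
Proof. by move=> aD; rewrite /out /base_out aD. Qed.

Lemma out_tail s : out c s (size D) = tail_out s.
Proof. by rewrite /out /base_out ltnn eqxx (gtn_eqF mark_lt) andbF. Qed.

Lemma out_beyond s a : (size D < a)%N -> out c s a = [::].
Proof.
move=> aD; rewrite /out /base_out ltnNge ltnW //= (gtn_eqF aD).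
by rewrite (gtn_eqF (ltn_trans mark_lt aD)) andbF.
Qed.

Lemma accepts_cons s rho p w : accepts s rho (p :: w) <->
  foldr (fun x => or (sat (fun y => p.1 - rho y) (arrow_guard x) /\
      accepts (arrow_target x)
        (fun y => if y \in arrow_resets x then p.1 else rho y) w))
    False (out c s p.2).
Proof. by case: p => t a; rewrite -exists_in_foldr. Qed.

Lemma accepts_letter s rho p w : s != Delay -> (p.2 < size D)%N ->
  accepts s rho (p :: w) <->
  foldr (fun x => or (sat (fun y => p.1 - rho y) (arrow_guard x) /\
      accepts (arrow_target x)
        (fun y => if y \in arrow_resets x then p.1 else rho y) w))
    False (letter_out s p.2).
Proof. by move=> /negbTE sD pD; rewrite accepts_cons out_letter // sD. Qed.

Lemma accepts_Tail rho cs : is_tail cs -> accepts Tail rho cs.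
Proof.
elim: cs rho => [//|p cs IH] rho /andP[/eqP pD cs_tail].
apply/accepts_cons; rewrite pD out_tail /= reset_set0.
by left; split=> //; apply: IH.
Qed.

Lemma accepts_tail_letters s rho cs : is_tail cs ->
  s \in [:: Start; Found] -> accepts s rho cs.
Proof.
case: cs => [_|p cs /andP[/eqP pD cs_tail]]; rewrite !inE => /orP[]/eqP-> //;
  apply/accepts_cons; rewrite pD out_tail /= reset_set0; left; split=> //;
  exact: accepts_Tail.
Qed.

Lemma accepts_Found rho u cs :
  is_word u -> is_tail cs -> accepts Found rho (u ++ cs).
Proof.
elim: u rho => [|p u IH] rho; first by move=> _ /accepts_tail_letters; apply.
move=> /andP[pD uD] cs_tail; apply/accepts_letter => //=; rewrite reset_set0.
by left; split=> //; apply: IH.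
Qed.

Lemma accepts_Tail_nil rho u cs :
  is_word u -> accepts Tail rho (u ++ cs) -> u = [::].
Proof.
by case: u => // p u /andP[pD _]; rewrite cat_cons accepts_letter.
Qed.

Definition is_watching s := match s with
  | Gap | NextGap | Early | Delay | Match _ | Succ _ => true | _ => false end.

Lemma watching_not_accepts_tail s rho cs :
  is_tail cs -> is_watching s -> ~ accepts s rho cs.
Proof.
case: cs => [_ + s_final|p cs /andP[/eqP pD _] s_watch /accepts_cons].
  by have : s \in finals by []; rewrite !inE => /or4P[]/eqP->.
by rewrite pD out_tail; case: s s_watch.
Qed.

Lemma accepts_waiting s (wait hit : ('I_n -> R) -> event R -> Prop) :
  is_watching s ->
  (forall rho p w, (p.2 < size D)%N -> accepts s rho (p :: w) <->
     (wait rho p /\ accepts s rho w) \/ (hit rho p /\ accepts Found rho w)) ->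
  forall rho u cs, is_word u -> is_tail cs -> accepts s rho (u ++ cs) <->
    exists v p u', [/\ u = v ++ p :: u',
      forall p', p' \in v -> wait rho p' & hit rho p].
Proof.
move=> s_watch step rho u cs + cs_tail; elim: u => [|p u IH] /=.
  move=> _; split=> [/(watching_not_accepts_tail cs_tail s_watch)//|].
  by case=> -[|? ?] [? [? []]].
move=> /andP[pD uD]; rewrite step //; split.
  case=> [[wait_p /(IH uD)[v [p' [u' [-> wait_v hit_p']]]]]|[hit_p _]].
    exists (p :: v), p', u'; split=> // p2.
    by rewrite inE => /predU1P[->|/wait_v].
  by exists [::], p, u.
move=> [[|p1 v] [p' [u' [/= [pE uE] wait_v hit_p']]]]; subst.
  by right; split=> //; apply: accepts_Found.
left; split; first exact: wait_v (mem_head _ _).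
apply/IH => //; exists v, p', u'; split=> // p2 p2v.
by apply: wait_v; rewrite inE p2v orbT.
Qed.

Lemma accepts_Match b rho u cs : is_word u -> is_tail cs ->
  accepts (Match b) rho (u ++ cs) <-> exists v p u', [/\ u = v ++ p :: u',
    all (fun p' => p'.1 < rho clk0 + 1) v &
    (p.1 = rho clk0 + 1 /\ pop (rl p.2) != push (rl b)) \/
    (rho clk0 + 1 < p.1 /\ push (rl b) != None)].
Proof.
move=> uD cs_tail.
rewrite (@accepts_waiting _ (fun rho p => p.1 < rho clk0 + 1)
  (fun rho p => (p.1 = rho clk0 + 1 /\ pop (rl p.2) != push (rl b)) \/
    (rho clk0 + 1 < p.1 /\ push (rl b) != None))) //.
  by split=> -[v [p [u' [-> /allP wait hit]]]]; exists v, p, u'.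
move=> {}rho p w pD; rewrite accepts_letter //= !sat_when !reset_set0 /=.
rewrite subr_eq [1 + _]addrC ltrBlDl ltrBrDl; split.
  case=> [?|[[/andP[p_pop /eqP pE] ?]|[[/andP[b_push lt] ?]|//]]].
  - by left.
  - by right; split=> //; left.
  - by right; split=> //; right.
case=> [?|[[[-> p_pop]|[lt b_push]] ?]]; first by left.
  by right; left; rewrite eqxx p_pop.
by do 2!right; left; rewrite lt b_push.
Qed.

Lemma accepts_NextGap rho u cs : is_word u -> is_tail cs ->
  accepts NextGap rho (u ++ cs) <-> exists v p u', [/\ u = v ++ p :: u',
    pop (rl p.2) != None & rho clk0 + 1 < p.1 < rho clk1 + 1].
Proof.
move=> uD cs_tail; rewrite (@accepts_waiting _ (fun _ _ => True)
  (fun rho p => pop (rl p.2) != None /\ rho clk0 + 1 < p.1 < rho clk1 + 1)) //.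
  by split=> -[v [p [u' []]]]; [move=> -> _ [] | move=> -> ? ?];
    exists v, p, u'.
move=> {}rho p w pD; rewrite accepts_letter //= !sat_when !reset_set0 /=.
rewrite ltrBlDl ltrBrDl; split.
  by case=> [[_ ?]|[[/and3P[-> -> ->] ?]|//]]; [left | right].
by case=> [[_ ?]|[[-> ->] ?]]; [left | right; left].
Qed.

Lemma accepts_Early rho u cs : is_word u -> is_tail cs ->
  accepts Early rho (u ++ cs) <-> exists v p u', [/\ u = v ++ p :: u',
    pop (rl p.2) != None & p.1 < rho clk1 + 1].
Proof.
move=> uD cs_tail; rewrite (@accepts_waiting _ (fun _ _ => True)
  (fun rho p => pop (rl p.2) != None /\ p.1 < rho clk1 + 1)) //.
  by split=> -[v [p [u' []]]]; [move=> -> _ [] | move=> -> ? ?];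
    exists v, p, u'.
move=> {}rho p w pD; rewrite accepts_letter //= !sat_when !reset_set0 /=.
rewrite ltrBlDl; split.
  by case=> [[_ ?]|[[/andP[-> ->] ?]|//]]; [left | right].
by case=> [[_ ?]|[[-> ->] ?]]; [left | right; left].
Qed.

Lemma accepts_Delay rho u cs : is_word u -> is_tail cs ->
  accepts Delay rho (u ++ cs) <-> exists v t u', u = v ++ (t, mark) :: u' /\
    t != rho clk0 + c%:R.
Proof.
move=> uD cs_tail; rewrite (@accepts_waiting _ (fun _ _ => True)
  (fun rho p => p.2 = mark /\ p.1 != rho clk0 + c%:R)) //.
  split=> [[v [[t a] [u' [-> _ [/= -> ne]]]]]|[v [t [u' [-> ne]]]]].
    by exists v, t, u'.
  by exists v, (t, mark), u'.
move=> {}rho p w pD; rewrite accepts_cons out_letter //=.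
case: eqP => [p_mark|p_other] /=;
  rewrite !reset_set0 /= ?subr_eq ?[c%:R + _]addrC; split.
- by case=> [[lt ?]|[[_ ?]|//]]; [right | left].
- by case=> [[_ ?]|[[_ lt] ?]]; [right; left | left].
- by case=> [[_ ?]|//]; left.
- by case=> [[_ ?]|[[]]]; left.
Qed.

Lemma accepts_Succ b rho u cs : is_word u -> is_tail cs ->
  accepts (Succ b) rho (u ++ cs) <-> exists p u', u = p :: u' /\
    tgt (rl b) != src (rl p.2).
Proof.
case: u => [|p u] uD cs_tail.
  split; last by case=> ? [? []].
  by move=> /(@watching_not_accepts_tail (Succ b) _ _ cs_tail isT).
case/andP: uD => pD uD; rewrite accepts_letter //= sat_when reset_set0; split.
  by case=> [[/andP[ne _] _]|//]; exists p, u.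
case=> p' [u' [[<- _] ->]]; left; split=> //; exact: accepts_Found.
Qed.

Lemma accepts_Gap rho u cs : is_word u -> is_tail cs ->
  accepts Gap rho (u ++ cs) <->
  exists p u', u = p :: u' /\
    (pop (rl p.2) != None /\ rho clk0 + 1 < p.1 \/
     exists v p' u2, [/\ u' = v ++ p' :: u2, pop (rl p'.2) != None &
       rho clk0 + 1 < p'.1 < p.1 + 1]).
Proof.
case: u => [|p u] uD cs_tail.
  by split=> [/(@watching_not_accepts_tail Gap _ _ cs_tail isT)|[? [? []]]].
case/andP: uD => pD uD.
rewrite accepts_letter //= sat_when reset_set0 reset_set1 /=.
rewrite accepts_NextGap // /set_clock eqxx (negbTE clk01) ltrBrDl; split.
  case=> [[_ gap]|[[/andP[p_pop lt] _]|//]]; exists p, u; split=> //.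
    by right.
  by left.
case=> p' [u' [[<- <-] [[p_pop lt]|gap]]]; last by left.
by right; left; rewrite p_pop lt; split=> //; apply: accepts_Found.
Qed.

Lemma accepts_Guess rho u cs : is_word u -> is_tail cs ->
  accepts Guess rho (u ++ cs) <->
  (exists v p u', u = v ++ p :: u' /\
    [\/ accepts (Succ p.2) rho (u' ++ cs),
        accepts (Match p.2) (set_clock rho clk0 p.1) (u' ++ cs),
        accepts Gap (set_clock rho clk0 p.1) (u' ++ cs) |
        tgt (rl p.2) != halt /\ u' = [::]]) \/
  accepts Guess rho cs.
Proof.
move=> + cs_tail; elim: u => [|p u IH] uD.
  by split=> [|[[[|? ?] [? [? []]]]|]] //; right.
case/andP: uD => pD uD.
rewrite accepts_letter //= sat_when !reset_set0 !reset_set1 (IH uD); split.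
  case=> [[_ [[v [p' [u' [-> found]]]]|skip]]|found]; last 1 first.
  - left; exists [::], p, u; split=> //.
    case: found => [[_ ?]|[[_ ?]|[[_ ?]|[[/andP[ne _] tail]|//]]]].
    + by constructor 1.
    + by constructor 2.
    + by constructor 3.
    + by constructor 4; split=> //; apply: accepts_Tail_nil uD tail.
  - by left; exists (p :: v), p', u'.
  - by right.
case=> [[[|p1 v] [p' [u' [/= [pE uE] found]]]]|skip].
- subst p' u'; right; case: found => [?|?|?|[ne ->]].
  + by left.
  + by right; left.
  + by do 2!right; left.
  + by do 3!right; left; rewrite ne; split=> //; apply: accepts_Tail.
- by left; split=> //; left; exists v, p', u'.
- by left; split=> //; right.
Qed.

Lemma accepts_Start rho u cs : is_word u -> is_tail cs ->
  accepts Start rho (u ++ cs) <-> u = [::] \/ exists p u', u = p :: u' /\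
    [\/ src (rl p.2) != start, pop (rl p.2) != None,
        accepts Early (set_clock rho clk1 p.1) (u' ++ cs) |
        accepts Delay (set_clock rho clk0 p.1) (u' ++ cs)].
Proof.
case: u => [|p u] uD cs_tail.
  by split=> _; [left | apply: accepts_tail_letters].
case/andP: uD => pD uD.
rewrite accepts_letter //= !sat_when !reset_set0 !reset_set1; split.
  case=> [[/andP[ne _] _]|[[/andP[p_pop _] _]|[[_ early]|[[_ delay]|//]]]];
    right; exists p, u; split=> //.
  + by constructor 1.
  + by constructor 2.
  + by constructor 3.
  + by constructor 4.
case=> // -[p' [u' [[<- <-] [ne|p_pop|early|delay]]]].
- by left; rewrite ne; split=> //; apply: accepts_Found.
- by right; left; rewrite p_pop; split=> //; apply: accepts_Found.
- by do 2!right; left.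
- by do 3!right; left.
Qed.

Local Notation faulty := (faulty r0 D start halt mark c).

Lemma is_word_suffix u p u' : is_word (u ++ p :: u') -> is_word u'.
Proof. by rewrite /is_word all_cat /= => /and3P[]. Qed.

Lemma accepts_Guess_faulty u cs : increasing 0 u -> is_word u -> is_tail cs ->
  accepts Guess (fun=> 0) (u ++ cs) -> faulty u \/ accepts Guess (fun=> 0) cs.
Proof.
move=> inc uD cs_tail /accepts_Guess-/(_ uD cs_tail)[|]; last by right.
move=> [v [p [u' [uE found]]]]; left; subst u.
have u'D := is_word_suffix uD; case: found.
- move/accepts_Succ => /(_ u'D cs_tail)[p' [u2 [-> ne]]].
  exact: faulty_state.
- move/accepts_Match => /(_ u'D cs_tail)[v' [p' [u2 [-> v'_lt bad]]]].
  by rewrite /set_clock eqxx in v'_lt bad; apply: faulty_push.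
- move/accepts_Gap => /(_ u'D cs_tail)[p' [u2 [u'E]]]; rewrite /set_clock eqxx.
  case=> [[p'_pop lt]|[v' [p2 [u3 [u2E p2_pop /andP[lt p2_lt]]]]]]; subst.
    by rewrite -[p' :: u2]cat0s; apply: faulty_pop.
  rewrite -cat_cons; apply: faulty_pop => //=.
  rewrite p2_lt /=; move: inc; rewrite -cat_rcons => /increasing_split[_].
  by rewrite all_cat => /andP[+ _]; apply: sub_all => p3; lra.
- by case=> ne u'0; rewrite u'0 cats1; apply: faulty_halt.
Qed.

Lemma accepts_Start_faulty u cs : increasing 0 u -> is_word u -> is_tail cs ->
  accepts Start (fun=> 0) (u ++ cs) -> faulty u.
Proof.
move=> inc uD cs_tail /accepts_Start-/(_ uD cs_tail)[->|[p [u' [uE found]]]].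
  exact: faulty_nil.
subst u; have u'D : is_word u' by case/andP: uD.
case: found => [ne|p_pop||]; first exact: faulty_start.
- by rewrite -[p :: u']cat0s; apply: faulty_early_pop.
- move/accepts_Early => /(_ u'D cs_tail)[v [p' [u2 [u'E p'_pop]]]].
  rewrite /set_clock eqxx => p'_lt; subst u'.
  rewrite -cat_cons; apply: faulty_early_pop => //=.
  have [_] := @increasing_split R 0 [::] p (v ++ p' :: u2) inc.
  by rewrite p'_lt /= all_cat => /andP[+ _]; apply: sub_all => p2; lra.
- move/accepts_Delay => /(_ u'D cs_tail)[v [t [u2 [-> ne]]]].
  by rewrite /set_clock eqxx in ne; apply: faulty_mark.
Qed.

Lemma faulty_accepts u cs : is_word u -> is_tail cs -> faulty u ->
  accepts Guess (fun=> 0) (u ++ cs) \/ accepts Start (fun=> 0) (u ++ cs).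
Proof.
move=> uD cs_tail; rewrite accepts_Guess // accepts_Start // => u_faulty.
case: u_faulty uD => {u}.
- by move=> _; right; left.
- by move=> p u' ne _; right; right; exists p, u'; split=> //; constructor 1.
- move=> v p ne _; left; left; exists v, p, [::]; rewrite cats1; split=> //.
  by constructor 4.
- move=> v p p' u' ne /is_word_suffix uD; left; left; exists v, p, (p' :: u').
  by split=> //; constructor 1; apply/accepts_Succ => //; exists p', u'.
- move=> v p v' p' u' v'_lt bad /is_word_suffix uD; left; left.
  exists v, p, (v' ++ p' :: u'); split=> //; constructor 2.
  by apply/accepts_Match => //; exists v', p', u'; rewrite /set_clock eqxx.
- move=> v p v' p' u' late v'_late p'_pop /is_word_suffix uD; left; left.
  exists v, p, (v' ++ p' :: u'); split=> //; constructor 3.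
  apply/accepts_Gap => //; rewrite /set_clock eqxx.
  case: v' v'_late {uD} => [|p2 v'] /=.
    by exists p', u'; split=> //; left.
  case/andP=> p2_late v'_late; exists p2, (v' ++ p' :: u'); split=> //; right.
  by exists v', p', u'; rewrite late p2_late.
- move=> [|p v] p' u' v_late p'_pop uD; right; right.
    by exists p', u'; split=> //; constructor 2.
  exists p, (v ++ p' :: u'); split=> //; constructor 3.
  apply/accepts_Early => //; first by case/andP: uD.
  by exists v, p', u'; rewrite /set_clock eqxx; split=> //; case/andP: v_late.
- move=> p v t' u' ne uD; right; right.
  exists p, (v ++ (t', mark) :: u'); split=> //; constructor 4.
  apply/accepts_Delay => //; first by case/andP: uD.
  by exists v, t', u'; rewrite /set_clock eqxx.
Qed.

Definition chain_state j := if j is 0%N then Guess else Chain j.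

(* Clock [i] was reset at the letter number [i] of [past]. *)
Definition remembers rho (past : seq (event R)) := forall i, (i < n)%N ->
  ((i < size past)%N -> rho (inord i) = nth 0 (unzip1 past) i) /\
  ((n + i < size past)%N ->
     nth 0 (unzip1 past) (n + i) - nth 0 (unzip1 past) i = 1).

Lemma remembers_rcons_reset rho past p :
  (size past < n)%N -> remembers rho past ->
  remembers (set_clock rho (inord (size past)) p.1) (rcons past p).
Proof.
move=> past_n past_ok i i_n; rewrite size_rcons /unzip1 map_rcons; split=> [|?].
  rewrite ltnS leq_eqVlt nth_rcons size_map => /predU1P[->|i_past].
    by rewrite /set_clock eqxx ltnn eqxx.
  rewrite i_past -(past_ok i i_n).1 // /set_clock ifF //.
  by rewrite -val_eqE /= !inordK; lia.
by lia.
Qed.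

Lemma remembers_rcons rho past p : (n <= size past)%N -> remembers rho past ->
  p.1 - nth 0 (unzip1 past) (size past - n) = 1 -> remembers rho (rcons past p).
Proof.
move=> n_past past_ok p_delay i i_n; have [rho_i delay_i] := past_ok i i_n.
have i_past := leq_trans i_n n_past.
rewrite size_rcons /unzip1 map_rcons !nth_rcons size_map i_past; split=> [_|].
  exact: rho_i.
rewrite ltnS leq_eqVlt => /predU1P[niE|ni_past].
  by rewrite niE ltnn eqxx -p_delay -niE addKn.
by rewrite ni_past delay_i.
Qed.

Lemma accepts_chain past rho cs : is_tail cs -> remembers rho past ->
  accepts (chain_state (size past)) rho cs <-> unit_delays n (past ++ cs).
Proof.
elim: cs past rho => [|p cs IH] past rho.
  move=> _ past_ok; rewrite cats0; split=> [past_final|[sz _]].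
    have sz : size past = n.*2.
      have : chain_state (size past) \in finals by [].
      rewrite !inE => /or4P[]/eqP; case: (size past) => // j chainE.
      by have := congr1 num chainE; rewrite /=; lia.
    by split=> // i i_n; apply: (past_ok i i_n).2; rewrite sz -addnn ltn_add2l.
  by rewrite sz /accepts_graph !inE eqxx !orbT.
case/andP=> /eqP pD cs_tail past_ok; rewrite accepts_cons pD out_tail.
have -> : tail_out (chain_state (size past)) = chain_out (size past).
  by case: (size past).
have step rho' : remembers rho' (rcons past p) ->
    accepts (Chain (size past).+1) rho' cs <-> unit_delays n (past ++ p :: cs).
  by move=> ?; rewrite -cat_rcons -(IH (rcons past p) rho') // size_rcons.
rewrite /chain_out; case: ltnP => [past_n|n_past] /=.
  rewrite reset_set1 step; last exact: remembers_rcons_reset.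
  by split=> [[[_]|]|] //; left.
case: ltnP => [past_2n|n2_past] /=; last first.
  by split=> // -[sz _]; move: n2_past; rewrite -sz size_cat /=; lia.
have past_n : (size past - n < n)%N by rewrite -addnn in past_2n; lia.
have lt_past : (size past - n < size past)%N by lia.
rewrite reset_set0 (past_ok _ past_n).1 //.
split=> [[[/eqP p_delay]|//]|delays].
  by rewrite step //; apply: remembers_rcons.
have p_delay : p.1 - nth 0 (unzip1 past) (size past - n) = 1.
  have [_ /(_ _ past_n)] := delays; rewrite subnKC // /unzip1 map_cat !nth_cat.
  by rewrite size_map ltnn subnn lt_past.
by left; rewrite p_delay eqxx step //; apply: remembers_rcons.
Qed.

Lemma accepts_Guess_tail cs : is_tail cs ->
  accepts Guess (fun=> 0) cs <-> unit_delays n cs.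
Proof. by move=> cs_tail; apply: (@accepts_chain [::]). Qed.

Lemma accepts_initials u cs : increasing 0 u -> is_word u -> is_tail cs ->
  (exists2 s, s \in initials & accepts s (fun=> 0) (u ++ cs)) <->
  faulty u \/ unit_delays n cs.
Proof.
move=> inc uD cs_tail; rewrite -accepts_Guess_tail //; split.
  move=> [s]; rewrite !inE => /orP[]/eqP->.
    exact: accepts_Guess_faulty.
  by move/accepts_Start_faulty; left; auto.
case=> [/(faulty_accepts uD cs_tail)[]|tail_ok].
- by exists Guess.
- by exists Start.
- by exists Guess => //; apply/accepts_Guess => //; right.
Qed.

Lemma accepts_word_tail s rho w : accepts s rho w -> exists u cs,
  [/\ w = u ++ cs, is_word u, is_tail cs &
      match s with Tail | Chain _ => u = [::] | _ => True end].
Proof.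
elim: w s rho => [|p w IH] s rho.
  by move=> _; exists [::], [::]; split=> //; case: s.
case: p => t a [x x_out [_ /IH[u [cs [-> uD cs_tail u_nil]]]]].
case: (ltngtP a (size D)) => [aD|Da|aE].
- exists ((t, a) :: u), cs; rewrite /is_word /= aD; split=> //.
  by move: x_out; rewrite out_letter //; case: s.
- by rewrite out_beyond in x_out.
suff u0 : u = [::].
  exists [::], ((t, a) :: cs); rewrite u0 /is_tail /= aE eqxx.
  by split=> //; case: (s).
rewrite aE out_tail in x_out; have u0_chain j : x \in chain_out j -> u = [::].
  rewrite /chain_out; case: ifP => _; [|case: ifP => _ //];
    by rewrite inE => /eqP xE; rewrite xE in u_nil.
case: s x_out => [||||||||j|j|j] //=; try exact: u0_chain;
  by rewrite inE => /eqP xE; rewrite xE in u_nil.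
Qed.

End FaultFinder.

(** * The code of the fault-finding automaton *)

Section Edges.
Variables (Q S : eqType) (r0 : rule Q S) (D : seq (rule Q S)).
Variables (start halt : Q) (mark m : nat).
Let n := m.+2.
Hypothesis mark_lt : mark < size D.
Local Notation base_out := (base_out r0 D start halt m).
Local Notation out := (out r0 D start halt mark m).

Definition valid_state s := match s with
  | Chain j => j <= n.*2 | Match a | Succ a => a < size D | _ => true end.

Definition states :=
  [:: Guess; Start; Found; Tail; Gap; NextGap; Early; Delay] ++
  map Chain (iota 0 n.*2.+1) ++ map Match (iota 0 (size D)) ++
  map Succ (iota 0 (size D)).

Lemma mem_states s : (s \in states) = valid_state s.
Proof.
apply/idP/idP.
  rewrite !mem_cat => /or4P[|/mapP[j + ->]|/mapP[a + ->]|/mapP[a + ->]].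
  - by rewrite !inE; do 7?[case/predU1P=> [->|] //]; move/eqP->.
  - by rewrite mem_iota.
  - by rewrite mem_iota.
  - by rewrite mem_iota.
rewrite !mem_cat; case: s => [||||||||j|a|a] s_valid; apply/or4P;
  try by constructor 1.
- by constructor 2; apply: map_f; rewrite mem_iota.
- by constructor 3; apply: map_f; rewrite mem_iota.
- by constructor 4; apply: map_f; rewrite mem_iota.
Qed.

Definition base_edges : seq (state * nat * arrow n state) :=
  [seq (sa, x) | sa <- [seq (s, a) | s <- states, a <- iota 0 (size D).+1],
                 x <- base_out sa.1 sa.2].

Definition edges c := (Delay, mark, late_mark m c) :: base_edges.

Lemma mem_base_edges s a x : ((s, a, x) \in base_edges) =
  [&& valid_state s, a <= size D & x \in base_out s a].
Proof.
rewrite -mem_states; apply/allpairsPdep/and3P.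
  move=> [_ [y [/allpairsP[[s' a'] [s'_in a'_in ->]] y_out [-> -> ->]]]].
  by rewrite mem_iota in a'_in.
move=> [s_in aD x_out]; exists (s, a), x; split=> //.
by apply: allpairs_f; rewrite ?mem_iota.
Qed.

Lemma mem_edges c s a x : valid_state s ->
  ((s, a, x) \in edges c) = (x \in out c s a).
Proof.
move=> s_valid; rewrite inE mem_base_edges s_valid /out.
have -> : (a <= size D) && (x \in base_out s a) = (x \in base_out s a).
  by rewrite andb_idl // /base_out; case: ltngtP.
by rewrite !xpair_eqE; case: ifP => //= _; rewrite inE.
Qed.

Lemma out_valid c s a x : valid_state s -> x \in out c s a ->
  valid_state (arrow_target x).
Proof.
have chain_valid j : x \in chain_out m j -> valid_state (arrow_target x).
  rewrite /chain_out; case: ltnP => [jn|_]; rewrite ?inE.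
    by move/eqP->; rewrite /= -addnn; lia.
  by case: ltnP => // jn; rewrite inE => /eqP->.
move=> s_valid.
suff base_valid : x \in base_out s a -> valid_state (arrow_target x).
  by rewrite /out; case: ifP => // _; rewrite inE => /predU1P[->|].
rewrite /base_out; case: ltngtP => // [aD|_].
  case: s s_valid => [||||||||j|b|b] //= s_valid; rewrite !inE;
    by repeat (case/predU1P=> [->|] //); move/eqP->.
by case: s s_valid => [||||||||j|b|b] //= s_valid; try exact: chain_valid;
  rewrite inE => /eqP->.
Qed.

Definition quine := CodeSeq.code (map (edge_code num) base_edges).

Lemma base_edges_lt_quine e : e \in base_edges ->
  [/\ num e.1.1 < quine, e.1.2 < quine & num (arrow_target e.2) < quine].
Proof.
move=> e_base; have e_lt : edge_code num e < quine.
  by apply: (allP (CodeSeq.ltn_code _)); apply: map_f.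
have := CodeSeq.ltn_code [:: num e.1.1; e.1.2; guard_code (arrow_guard e.2);
  set_code (arrow_resets e.2); num (arrow_target e.2)].
rewrite -/(edge_code num e) => /and5P[? ? _ _ /andP[? _]].
by split; apply: ltn_trans e_lt.
Qed.

Lemma size_lt_quine : size D < quine.
Proof.
have [|_ ? _ //] := @base_edges_lt_quine
  (Tail, size D, Arrow (GTrue n) finset.set0 Tail).
by rewrite mem_base_edges /base_out ltnn eqxx leqnn mem_head.
Qed.

Lemma valid_state_lt_quine s : valid_state s -> num s < quine.
Proof.
have last_chain : num (Chain n.*2) < quine.
  have [|_ _ //] := @base_edges_lt_quine (Chain n.*2.-1, size D,
    Arrow (GAtom (inord (n.*2.-1 - n)) OpEq 1) finset.set0 (Chain n.*2)).
  rewrite mem_base_edges; apply/and3P.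
  split; [exact: leq_pred | exact: leqnn |].
  rewrite /base_out ltnn eqxx /tail_out /chain_out ifF; last first.
    by rewrite -addnn; lia.
  by rewrite ifT; [exact: mem_head | exact: leqnn].
have D_gt0 : 0 < size D by apply: leq_ltn_trans mark_lt.
case: s => [||||||||j|a|a] /= s_valid; try by move: last_chain => /=; lia.
- have [|//] := @base_edges_lt_quine (Match a, 0,
    Arrow (GAtom (clk0 m) OpLt 1) finset.set0 (Match a)).
  by rewrite mem_base_edges /base_out D_gt0 /= s_valid mem_head.
- have [|//] := @base_edges_lt_quine (Succ a, 0, Arrow
    (when (tgt (letter_rule r0 D a) != src (letter_rule r0 D 0)) (GTrue n))
    finset.set0 Found).
  by rewrite mem_base_edges /base_out D_gt0 /= s_valid mem_head.
Qed.

Lemma quine_gt0 : 0 < quine.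
Proof. exact: leq_ltn_trans size_lt_quine. Qed.

Lemma edges_bounded c : all (edge_bounded num quine.-1 quine.-1) (edges c).
Proof.
have le_pred x : x < quine -> x <= quine.-1 by case: quine.
apply/allP => e; rewrite inE => /predU1P[->|/base_edges_lt_quine[? ? ?]].
  apply/and3P; split; apply: le_pred; try exact: valid_state_lt_quine.
  exact: ltn_trans size_lt_quine.
by apply/and3P; split; apply: le_pred.
Qed.

(* Only [late_mark] mentions the code of the list of all other edges, so that
   the code of the automaton can be computed from that of the list. *)
Definition fault_finder : timed_automaton quine.-1.+1 n :=
  numbered_automaton num quine.-1 quine.-1 initials (finals m) (edges quine).

Lemma fault_finder_code :
  automaton_code (existT _ _ fault_finder) = CodeSeq.code [:: quine; quine;
    CodeSeq.code (map num initials); CodeSeq.code (map num (finals m));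
    CodeSeq.code (edge_code num (Delay, mark, late_mark m quine) ::
                  map (edge_code num) base_edges)].
Proof.
have num_le s : valid_state s -> num s <= quine.-1.
  by move/valid_state_lt_quine; case: quine.
rewrite numbered_automaton_code ?edges_bounded // ?prednK ?quine_gt0 //.
- exact: (sub_all num_le).
- by apply: (sub_all num_le); rewrite /= leqnn.
Qed.

End Edges.

Fixpoint murec_const c :=
  if c is c'.+1 then MComp MSucc [:: murec_const c'] else MZero.

Definition murec_add := MPrimRec (MProj 0) (MComp MSucc [:: MProj 1]).
Definition murec_double := MComp murec_add [:: MProj 0; MProj 0].
Definition murec_cons :=
  MPrimRec (MComp MSucc [:: murec_double]) (MComp murec_double [:: MProj 1]).

Definition murec_code (gs : seq murec) :=
  foldr (fun g h => MComp murec_cons [:: g; h]) MZero gs.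

Lemma computes_nth i xs x :
  i < size xs -> nth 0 xs i = x -> computes (MProj i) xs x.
Proof. by move=> ? <-; constructor. Qed.

Lemma computes_comp1 f g xs y z :
  computes g xs y -> computes f [:: y] z -> computes (MComp f [:: g]) xs z.
Proof. by move=> cg; apply: computes_comp; do !constructor. Qed.

Lemma computes_comp2 f g1 g2 xs y1 y2 z :
  computes g1 xs y1 -> computes g2 xs y2 -> computes f [:: y1; y2] z ->
  computes (MComp f [:: g1; g2]) xs z.
Proof. by move=> cg1 cg2; apply: computes_comp; do !constructor. Qed.

Lemma computes_const c xs : computes (murec_const c) xs c.
Proof.
elim: c => [|c IH] /=; first by constructor.
by apply: computes_comp1 IH _; constructor.
Qed.

Lemma computes_add x y : computes murec_add [:: x; y] (x + y).
Proof.
elim: x => [|x IH]; first by constructor; apply: computes_nth.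
apply: computes_primrecS IH _.
by apply: (computes_comp1 (y := x + y)); [apply: computes_nth | constructor].
Qed.

Lemma computes_double x xs : computes murec_double (x :: xs) x.*2.
Proof.
rewrite -addnn; apply: computes_comp2 (computes_add _ _);
  exact: computes_nth.
Qed.

Lemma computes_code_cons x y : computes murec_cons [:: x; y] (2 ^ x * y.*2.+1).
Proof.
elim: x => [|x IH].
  rewrite mul1n; constructor; apply: computes_comp1 (computes_double _ _) _.
  by constructor.
apply: computes_primrecS IH _; rewrite expnS -mulnA mul2n.
by apply: computes_comp1 (computes_double _ _); apply: computes_nth.
Qed.

Lemma computes_code gs xs ys : computes_all gs xs ys ->
  computes (murec_code gs) xs (CodeSeq.code ys).
Proof.
elim: gs ys => [|g gs IH] ys cgs; inversion cgs; subst; first by constructor.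
by apply: computes_comp2 (computes_code_cons _ _); last exact: IH.
Qed.

Lemma computes_all_const c gs xs ys :
  computes_all gs xs ys -> computes_all (murec_const c :: gs) xs (c :: ys).
Proof. exact/computes_cons/computes_const. Qed.

Lemma computes_all_code gs hs xs ys zs :
  computes_all gs xs ys -> computes_all hs xs zs ->
  computes_all (murec_code gs :: hs) xs (CodeSeq.code ys :: zs).
Proof. by move=> /computes_code; apply: computes_cons. Qed.

Lemma computes_all_arg gs x xs ys : computes_all gs (x :: xs) ys ->
  computes_all (MProj 0 :: gs) (x :: xs) (x :: ys).
Proof. exact/computes_cons/computes_nth. Qed.

(* In [guard_code], 2 stands for [GNot] and 1 for [GAtom]. *)
Definition murec_late_mark m mark := murec_code [:: murec_const (num Delay);
  murec_const mark;
  murec_code [:: murec_const 2; murec_code [:: murec_const 1;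
    murec_const (val (clk0 m)); murec_const (comparison_op_code OpEq);
    MProj 0]];
  murec_const (set_code (finset.set0 : {set 'I_m.+2}));
  murec_const (num Found)].

Definition murec_fault_finder m mark := murec_code [:: MProj 0; MProj 0;
  murec_const (CodeSeq.code (map num initials));
  murec_const (CodeSeq.code (map num (finals m)));
  MComp murec_cons [:: murec_late_mark m mark; MProj 0]].

Lemma computes_late_mark m mark u : computes (murec_late_mark m mark) [:: u]
  (edge_code num (Delay, mark, late_mark m u)).
Proof.
apply: computes_code; do 2!apply: computes_all_const.
apply: computes_all_code; last by do 2!apply: computes_all_const; constructor.
apply: (@computes_all_const 2); apply: computes_all_code (computes_nil _).
by do 3!apply: computes_all_const; apply/computes_all_arg/computes_nil.
Qed.

Lemma computes_fault_finder (Q S : eqType) (r0 : rule Q S) D start halt mark m :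
  mark < size D ->
  computes (murec_fault_finder m mark) [:: quine r0 D start halt m]
    (automaton_code (existT _ _ (fault_finder r0 D start halt mark m))).
Proof.
move=> mark_lt; rewrite fault_finder_code //; apply: computes_code.
do 2!apply: computes_all_arg; do 2!apply: computes_all_const.
apply: computes_cons (computes_nil _).
apply: computes_comp2 (computes_late_mark _ _ _) _ (computes_code_cons _ _).
exact: computes_nth.
Qed.

(** * Reduction *)

Section TwoPhase.
Local Open Scope ring_scope.
Variables (R : realType) (k n d : nat).
Hypothesis d_le : (d <= k)%N.
Implicit Types (rho : 'I_n -> R) (w : seq (event R)).

Definition untimed_transition (s : 'I_2) (a : 'I_k.+1) (s' : 'I_2) :=
  Transition s a (GTrue n) finset.set0 s'.

Definition two_phase_automaton :=
  @TimedAutomaton k.+1 n 2 [set ord0] finset.setT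
  ([seq untimed_transition ord0 a ord0
    | a : 'I_k.+1 <- enum 'I_k.+1 & (a < d)%N] ++
   [seq untimed_transition s (inord d) ord_max | s <- [:: ord0; ord_max]]).

Lemma accepts_second_phase rho w :
  accepts_dates (A := two_phase_automaton) ord_max rho w <->
  all (fun p => p.2 == d) w.
Proof.
elim: w rho => [|[t a] w IH] rho /=; first by rewrite finset.in_setT.
split.
  move=> [e]; rewrite mem_cat => /orP[/mapP[b _ ->] []|] //.
  by rewrite !inE => /orP[]/eqP-> [] //= _ <- _ /IH->; rewrite inordK // eqxx.
move=> /andP[/eqP-> wd]; exists (untimed_transition ord_max (inord d) ord_max).
  by rewrite mem_cat !inE eqxx !orbT.
by split=> //=; [rewrite inordK | apply/IH].
Qed.

Lemma accepts_two_phase rho w :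
  accepts_dates (A := two_phase_automaton) ord0 rho w <->
  exists u cs, [/\ w = u ++ cs, all (fun p => p.2 < d)%N u &
                   all (fun p => p.2 == d) cs].
Proof.
elim: w rho => [|[t a] w IH] rho.
  by split=> [_|_]; [exists [::], [::] | rewrite /= finset.in_setT].
split.
  move=> [e]; rewrite mem_cat => /orP[/mapP[b]|].
    rewrite mem_filter => /andP[bd _] -> [_ /= <- _ /IH[u [cs [-> ud csd]]]].
    by exists ((t, b : nat) :: u), cs; rewrite /= bd.
  rewrite !inE => /orP[]/eqP-> [] //= _ <- _ /accepts_second_phase wd.
  by exists [::], ((t, d) :: w); rewrite inordK //= eqxx.
move=> [[|p u] [cs [/= wE ud csd]]].
  rewrite -wE in csd; case/andP: csd => /eqP/= -> wd.
  exists (untimed_transition ord0 (inord d) ord_max).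
    by rewrite mem_cat !inE eqxx orbT.
  by split=> //=; [rewrite inordK | apply/accepts_second_phase].
case: wE ud => <- wE /andP[/= ad ud].
have ak : (a < k.+1)%N := leqW (leq_trans ad d_le).
exists (untimed_transition ord0 (Ordinal ak) ord0).
  rewrite mem_cat; apply/orP; left; apply/mapP; exists (Ordinal ak) => //.
  by rewrite mem_filter mem_enum /= ad.
by split=> //=; apply/IH; exists u, cs.
Qed.

End TwoPhase.

Section Reduction.
Local Open Scope ring_scope.
Variables (R : realType) (Q S : eqType) (r0 : rule Q S) (D : seq (rule Q S)).
Variables (start halt : Q) (mark m : nat).
Hypothesis mark_lt : (mark < size D)%N.
Let u := quine r0 D start halt m.
Let A := fault_finder r0 D start halt mark m.
Local Notation faulty := (faulty r0 D start halt mark u).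

Let u_gt0 : (0 < u)%N. Proof. exact: quine_gt0. Qed.

Let sizeD_le : (size D <= u.-1)%N.
Proof. by rewrite -ltnS prednK // size_lt_quine. Qed.

Lemma accepted_fault_finder (w : seq (event R)) :
  all (fun p => p.2 < u.-1.+1)%N w ->
  accepted A w <-> exists2 s, s \in initials &
    accepts_graph (out r0 D start halt mark m u) (finals m) s (fun=> 0) w.
Proof.
apply: (@accepted_numbered _ _ _ num_inj _ _ _ _ _ _ _ (valid_state D m)) => //.
- exact: edges_bounded.
- by move=> s a x; apply: mem_edges.
- by move=> s a x; apply: out_valid.
- move=> s /(valid_state_lt_quine r0 start halt mark_lt).
  by rewrite -/u; case: (u).
Qed.

Lemma all_faulty_reducible p :
  (forall v : seq (event R), increasing 0 v -> is_word D v -> faulty v) ->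
  exists B : timed_automaton u.-1.+1 p, language R B = language R A.
Proof.
move=> all_faulty; exists (two_phase_automaton u.-1 p (size D)).
apply/language_eqP => w inc wu; rewrite accepted_fault_finder //; split.
  move=> [s]; rewrite inE => /eqP-> /accepts_two_phase-/(_ sizeD_le).
  move=> [v [cs [wE vD csD]]]; rewrite wE increasing_cat in inc *.
  case/andP: inc => inc _.
  by apply/accepts_initials => //; left; apply: all_faulty.
move=> [s _ /(accepts_word_tail mark_lt)[v [cs [-> vD csD _]]]].
exists ord0; first by rewrite inE.
by apply/accepts_two_phase => //; exists v, cs.
Qed.

Lemma not_faulty_irreducible p (v : seq (event R)) : (p < m.+2)%N ->
  increasing 0 v -> is_word D v -> ~ faulty v ->
  ~ exists B : timed_automaton u.-1.+1 p, language R B = language R A.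
Proof.
move=> pm inc vD v_ok [B /language_eqP BA].
apply: (unit_delays_need_clocks (d := size D) (B := B) pm inc) => cs inc_cs csD.
have wu : all (fun p => p.2 < u.-1.+1)%N (v ++ cs).
  rewrite all_cat; apply/andP; split.
    by apply: sub_all vD => q qD; rewrite ltnS (leq_trans (ltnW qD)).
  by apply: sub_all csD => q /eqP->; rewrite ltnS.
rewrite BA // accepted_fault_finder // accepts_initials //.
by split=> [[/v_ok|]|]; last by right.
Qed.

End Reduction.

Theorem theorem2 (R : realType) (n : nat) (hn : 2 <= n) :
  ~ algorithmically_decidable (@automaton_code n)
      (fun A : {k : nat & timed_automaton k n} =>
         exists B : timed_automaton (tag A) n.-1,
           language R B = language R (tagged A)).
Proof.
case: n hn => [|[|m]] // _ [f f_decides].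
pose g := MComp f [:: murec_fault_finder m 0]; pose p := decision_prog g.
pose D := machine p; pose u := quine load_end D LoadStart (halt_state p) m.
pose A := fault_finder load_end D LoadStart (halt_state p) 0 m.
have mark_lt : 0 < size D by [].
have u_gt0 : 0 < u by apply: quine_gt0.
have run_g y : computes f [:: automaton_code (existT _ _ A)] y ->
    computes g [:: u] y.
  exact/computes_comp1/computes_fault_finder.
have [f_yes f_no] := f_decides (existT _ _ A).
have [red|irred] := pselect (exists B : timed_automaton u.-1.+1 m.+1,
    language R B = language R A).
  have [w halts] := decision_halts (@represents_input (reg_bound p) u isT)
    (run_g _ (f_yes red)).
  have [v [inc vD v_run]] := codes_halting_run_of_reaches R u_gt0 halts.
  exact: not_faulty_irreducible (codes_run_not_faulty v_run) red.
apply: (irred); apply: all_faulty_reducible => // v inc vD.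
apply: contrapT => v_ok; have [w [w' [rep halts]]] :=
  reaches_of_codes_halting_run (not_faulty_codes_run inc vD v_ok).
by apply: (decision_never_halts rep _ halts); apply/run_g/f_no.
Qed.
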